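(* Assume $\rho>\lambda+\tau$. Let $x^1\in\mathcal X$, let $K,m\ge 1$ be integers, let $\alpha_0\in(0,\infty)$, and set $\eta=\frac{\sqrt{K}}{\alpha_0\sqrt{m}}$. Run the minibatch stochastic model-based method for $K$ iterations with constant batch size $m_k=m$ and constant parameter $\gamma_k=\gamma=\max\{\rho+\tau,\ \lambda+\eta\}$. Let $\Delta=f_{1/\rho}(x^{1})-\min_{x}f(x)$ and let $k^*$ be an index chosen uniformly at random in $\{1,2,\ldots,K\}$. Then $$\mathbb{E}\big[\|\nabla f_{1/\rho}(x^{k^{*}})\|^{2}\big]\le\frac{\rho}{\rho-\lambda-\tau}\bigg[\frac{(2\rho-\lambda)\Delta}{K}+ \Big(\frac{\Delta}{\alpha_0}+2\alpha_0\rho L^2\Big) \frac{1}{\sqrt{mK}}\bigg].$$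
   Context: Setting: $\mathcal X\subseteq\mathbb R^d$ is a nonempty closed convex set, $\xi$ is a random sample with distribution $\Xi$, and $f(x)=\mathbb E_{\xi\sim\Xi}[f(x,\xi)]$ is to be minimized over $\mathcal X$; $f$ is bounded below, and $\min_x f(x)$ denotes its minimal value over $\mathcal X$. $\|\cdot\|$ is the Euclidean norm. A function $g$ is $\lambda$-weakly convex if $g+\frac{\lambda}{2}\|\cdot\|^2$ is convex. Each $f(\cdot,\xi)$ is continuous and $\mu$-weakly convex with $\mu<\lambda+\tau$. For each $x\in\mathcal X$ and $\xi$ a model function $f_x(\cdot,\xi)$ is given such that, for constants $\lambda\ge 0$, $\tau\ge 0$, $L>0$ and all $\xi\sim\Xi$: (i) for all $x\in\mathcal X$, $y\mapsto f_x(y,\xi)$ is $\lambda$-weakly convex; (ii) $f_x(x,\xi)=f(x,\xi)$ for all $x\in\mathcal X$; (iii) $|f_x(y,\xi)-f(y,\xi)|\le\frac{\tau}{2}\|x-y\|^2$ for all $x,y\in\mathcal X$; (iv) $f_x(z,\xi)-f_x(y,\xi)\le L\|z-y\|$ for all $x,y,z\in\mathcal X$. Moreau envelope: for $\rho>\lambda+\tau$, $f_{1/\rho}(x)=\min_{y\in\mathcal X}\{f(y)+\frac{\rho}{2}\|x-y\|^2\}$; it is differentiable with $\nabla f_{1/\rho}(x)=\rho(x-\hat x)$, where $\hat x=\mathrm{argmin}_{y\in\mathcal X}\{f(y)+\frac{\rho}{2}\|x-y\|^2\}$. Minibatch stochastic model-based method: given $x^1\in\mathcal X$, at iteration $k=1,\dots,K$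 draw a batch $B_k=\{\xi_{k,1},\dots,\xi_{k,m_k}\}$ of i.i.d. samples from $\Xi$ (independent of the previous batches) and set $$x^{k+1}=\mathrm{argmin}_{x\in\mathcal X}\Big\{\frac{1}{m_k}\sum_{i=1}^{m_k}f_{x^k}(x,\xi_{k,i})+\frac{\gamma_k}{2}\|x-x^k\|^2\Big\}.$$ The index $k^*$ is independent of the samples, and the expectation is over all randomness. *)

(* Defs.v *)
From HB Require Import structures.
From mathcomp Require Import all_boot all_order all_algebra.
From mathcomp Require Import all_classical all_reals all_analysis.

Set Implicit Arguments.
Unset Strict Implicit.
Unset Printing Implicit Defensive.
Import Order.TTheory GRing.Theory Num.Theory.
Import numFieldNormedType.Exports.

Local Open Scope classical_set_scope.
Local Open Scope ring_scope.

(* The library's norm [`|x|] on ['rV[R]_d] is the sup norm; it induces the same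
   topology and the same notion of differentiability as the Euclidean norm. *)
Definition enorm (R : realType) (d : nat) (x : 'rV[R]_d) : R :=
  Num.sqrt (\sum_(i < d) x ord0 i ^+ 2).

(* The Borel sigma-algebra of R^d; [borel_rV R d] is convertible to ['rV[R]_d]. *)
Definition borel_rV (R : realType) (d : nat) :=
  g_sigma_algebraType (@open 'rV[R]_d).

Definition weakly_convex (R : realType) (d : nat) (X : set 'rV[R]_d) (l : R)
    (g : 'rV[R]_d -> R) : Prop :=
  convex_function (X : set (convex_lmodType 'rV[R]_d))
    (fun y => g y + l / 2 * enorm y ^+ 2).

Definition is_argmin (T : Type) (R : realType) (X : set T) (g : T -> R)
    (x : T) : Prop :=
  X x /\ forall y, X y -> g x <= g y.

(* [moreau X F rho] is f_{1/rho}: the parameter is rho, not 1/rho. *)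
Definition moreau (R : realType) (d : nat) (X : set 'rV[R]_d)
    (F : 'rV[R]_d -> R) (rho : R) (x : 'rV[R]_d) : R :=
  inf [set F y + rho / 2 * enorm (x - y) ^+ 2 | y in X].

(* The vector representing the Frechet derivative ['d g x]. *)
Definition gradient (R : realType) (d : nat) (g : 'rV[R]_d -> R)
    (x : 'rV[R]_d) : 'rV[R]_d :=
  \row_i 'd (g : 'rV[R]_d -> R^o) x (delta_mx ord0 i).

Definition mutually_independent (R : realType) (dO dS : measure_display)
    (Omega : measurableType dO) (S : measurableType dS) (P : probability Omega R)
    (I : finType) (Y : I -> {RV P >-> S}) : Prop :=
  forall (J : {set I}) (A : I -> set S), (forall i, measurable (A i)) ->
    (P (\bigcap_(i in [set` J]) (Y i @^-1` A i)) =
     \prod_(i in J) P (Y i @^-1` A i))%E.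

Definition generated_sigma_algebra (R : realType) (dO dS : measure_display)
    (Omega : measurableType dO) (S : measurableType dS) (P : probability Omega R)
    (I : Type) (Y : I -> {RV P >-> S}) : set (set Omega) :=
  <<s \bigcup_i preimage_set_system [set: Omega] (Y i) measurable >>.

Definition uniform_index (R : realType) (dO : measure_display)
    (Omega : measurableType dO) (P : probability Omega R) (K : nat)
    (N : Omega -> 'I_K) : Prop :=
  forall k : 'I_K, measurable (N @^-1` [set k]) /\
    P (N @^-1` [set k]) = (K%:R^-1)%:E.

Definition independent_index (R : realType) (dO : measure_display)
    (Omega : measurableType dO) (P : probability Omega R) (K : nat)
    (N : Omega -> 'I_K) (G : set (set Omega)) : Prop :=
  forall (k : 'I_K) (E : set Omega), G E ->
    (P (N @^-1` [set k] `&` E) = P (N @^-1` [set k]) * P E)%E.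

Definition model_based_objective (R : realType) (d : nat) (S : Type)
    (fm : 'rV[R]_d -> 'rV[R]_d -> S -> R) (gamma : R) (m : nat)
    (batch : 'I_m -> S) (x y : 'rV[R]_d) : R :=
  m%:R^-1 * \sum_(i < m) fm x y (batch i) + gamma / 2 * enorm (y - x) ^+ 2.

(* Iterations are numbered from 0: [x 0], ..., [x K] are x^1, ..., x^{K+1}, and
   [xi k i] is the (i+1)-st sample of the batch producing [x k.+1] from [x k]. *)
Definition minibatch_model_based_method (R : realType) (d : nat) (S Omega : Type)
    (X : set 'rV[R]_d) (fm : 'rV[R]_d -> 'rV[R]_d -> S -> R) (gamma : R)
    (K m : nat) (xi : 'I_K -> 'I_m -> Omega -> S) (x1 : 'rV[R]_d)
    (x : nat -> Omega -> 'rV[R]_d) : Prop :=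
  (forall w, x 0%N w = x1) /\
  (forall (k : 'I_K) (w : Omega),
     is_argmin X
       (model_based_objective fm gamma (fun i => xi k i w) (x k w))
       (x k.+1 w)).

(* Main.v *)
(* One step of the method is (gamma - lambda)-strongly convex minimization, so quadratic
   growth at x^{k+1}, tested at the proximal point of x^k, and quadratic growth of the
   proximal objective, tested at x^{k+1}, give for every realization
     |grad M(x^k)|^2 <= C1 (M(x^k) - M(x^{k+1})) + C2 E_k,    M = f_{1/rho},
   where E_k is the average over the batch of the gap between the sampled and the expected
   value of f_{x^k}(prox x^k, .) - f_{x^k}(x^{k+1}, .).  Replacing one sample of the batch
   moves the model values at x^{k+1} by at most 2 L^2 / (m (gamma - lambda)), and a ghost
   sample turns this stability into a bound on the expectation of E_k.  Summing over k
   telescopes.  Conditioning on all samples but one is expressed by the measurable space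
   Omega equipped with the sigma-algebra which these samples generate; since that requires
   the iterates to be measurable, minimizers of strongly convex functions are shown to
   depend measurably on parameters. *)

Require Import Defs.
From HB Require Import structures.
From mathcomp Require Import all_boot all_order all_algebra.
From mathcomp Require Import all_classical all_reals all_analysis.
From mathcomp Require Import measurable_realfun ring lra.

Set Implicit Arguments.
Unset Strict Implicit.
Unset Printing Implicit Defensive.
Import Order.TTheory GRing.Theory Num.Theory.
Import numFieldNormedType.Exports.

Local Open Scope classical_set_scope.
Local Open Scope ring_scope.

(** * Euclidean geometry *)

Section EuclideanNorm.
Context {R : realType} {d : nat}.
Implicit Types (u v w x y z : 'rV[R]_d) (t : R).

(** The obstacle is that x^{k+1} is computed from the very batch on which it is tested: given x^k,
    the batch average of the models is unbiased at prox x^k but not at x^{k+1}, so E_k has no reason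
    to have mean zero. With sigma = rho - lambda - tau the constants are C1 = rho (sigma + gamma -
    lambda) / sigma and C2 = rho^2 / sigma. The two entries of the maximum defining gamma serve
    different ends: gamma >= rho + tau lets the |x^{k+1} - x^k|^2 terms be dropped when the two
    growth inequalities are added, and gamma - lambda >= eta bounds the stability by 2 L^2 / (m
    eta). A large eta costs eta Delta / K through C1; the prescribed eta gives eta / K = 1 / (alpha0
    sqrt(m K)) and 1 / (m eta) = alpha0 / sqrt(m K), so both errors decay alike. The losses under P
    are differences of model values at points within a fixed distance of x^k, hence bounded by the
    Lipschitz property, so Fubini is needed for bounded functions only. The envelope telescopes for
    each outcome before integration, so no expectation of M(x^k) appears. *)

Definition dot u v : R := \sum_(i < d) u ord0 i * v ord0 i.

Lemma enorm_ge0 u : 0 <= enorm u.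
Proof. exact: sqrtr_ge0. Qed.

Lemma enorm_sqr u : enorm u ^+ 2 = \sum_(i < d) u ord0 i ^+ 2.
Proof. by rewrite sqr_sqrtr// sumr_ge0// => i _; rewrite sqr_ge0. Qed.

Lemma enormN u : enorm (- u) = enorm u.
Proof. by congr Num.sqrt; apply: eq_bigr => i _; rewrite mxE sqrrN. Qed.

Lemma enormB u v : enorm (u - v) = enorm (v - u).
Proof. by rewrite -opprB enormN. Qed.

Lemma enorm0 : enorm (0 : 'rV[R]_d) = 0.
Proof.
by rewrite /enorm big1 ?sqrtr0// => i _; rewrite mxE expr0n.
Qed.

Lemma enormZ t u : enorm (t *: u) = `|t| * enorm u.
Proof.
rewrite /enorm -sqrtr_sqr -sqrtrM ?sqr_ge0// mulr_sumr.
by congr Num.sqrt; apply: eq_bigr => i _; rewrite mxE exprMn.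
Qed.

Lemma coord_le_enorm u i : `|u ord0 i| <= enorm u.
Proof.
rewrite -sqrtr_sqr ler_wsqrtr// (bigD1 i)//= lerDl sumr_ge0// => j _.
exact: sqr_ge0.
Qed.

Lemma enorm_eq0 u : enorm u = 0 -> u = 0.
Proof.
move=> u0; apply/rowP => i; rewrite mxE; apply/eqP.
by rewrite -normr_le0 -u0 coord_le_enorm.
Qed.

Lemma dotNl u v : dot (- u) v = - dot u v.
Proof. by rewrite /dot -sumrN; apply: eq_bigr => i _; rewrite mxE mulNr. Qed.

Lemma enormD_sqr u v :
  enorm (u + v) ^+ 2 = enorm u ^+ 2 + dot u v *+ 2 + enorm v ^+ 2.
Proof.
rewrite !enorm_sqr /dot -sumrMnl -!big_split/=; apply: eq_bigr => i _.
by rewrite mxE sqrrD.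
Qed.

(** Stewart's identity. The convexity defect of a squared distance is exact, which is why adding a
    quadratic penalty of weight [gamma] shifts the modulus in [wconvexD_sqr] by exactly [gamma]. *)
Lemma enorm_comb_sqr t x y z :
  enorm (t *: y + (1 - t) *: z - x) ^+ 2 =
  t * enorm (y - x) ^+ 2 + (1 - t) * enorm (z - x) ^+ 2
  - t * (1 - t) * enorm (y - z) ^+ 2.
Proof.
rewrite !enorm_sqr !mulr_sumr -big_split -sumrB/=; apply: eq_bigr => i _.
by rewrite !mxE; ring.
Qed.

(** Cauchy-Schwarz, by expanding the square of [b u - a v] with [a] and [b] the norms of [u] and
    [v]; dividing by [a b] requires both to be nonzero. *)
Lemma dot_le u v : dot u v <= enorm u * enorm v.
Proof.
have [/enorm_eq0 ->|u0] := eqVneq (enorm u) 0.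
  by rewrite enorm0 mul0r /dot big1// => i _; rewrite mxE mul0r.
have [/enorm_eq0 ->|v0] := eqVneq (enorm v) 0.
  by rewrite enorm0 mulr0 /dot big1// => i _; rewrite mxE mulr0.
have ugt0 : 0 < enorm u by rewrite lt_neqAle eq_sym u0 enorm_ge0.
have vgt0 : 0 < enorm v by rewrite lt_neqAle eq_sym v0 enorm_ge0.
set a := enorm u; set b := enorm v.
have : 0 <= \sum_(i < d) (b * u ord0 i - a * v ord0 i) ^+ 2.
  by rewrite sumr_ge0// => i _; rewrite sqr_ge0.
suff -> : \sum_(i < d) (b * u ord0 i - a * v ord0 i) ^+ 2 =
    2 * (a * b) * (a * b - dot u v).
  by rewrite pmulr_rge0 ?subr_ge0// !mulr_gt0.
have -> : 2 * (a * b) * (a * b - dot u v) =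
  b ^+ 2 * a ^+ 2 - 2 * (a * b) * dot u v + a ^+ 2 * b ^+ 2 by ring.
rewrite [X in b ^+ 2 * X]enorm_sqr [X in a ^+ 2 * X]enorm_sqr.
rewrite /dot !mulr_sumr -sumrB -big_split/=.
by apply: eq_bigr => i _; ring.
Qed.

Lemma norm_dot_le u v : `|dot u v| <= enorm u * enorm v.
Proof.
rewrite ler_norml dot_le andbT lerNl -dotNl.
by apply: le_trans (dot_le _ _) _; rewrite enormN.
Qed.

Lemma enormD u v : enorm (u + v) <= enorm u + enorm v.
Proof.
rewrite -(@ler_pXn2r _ 2)// ?nnegrE ?addr_ge0 ?enorm_ge0//.
rewrite enormD_sqr sqrrD lerD2r lerD2l lerMn2r/=.
exact: dot_le.
Qed.

Lemma enorm_triangle x y z : enorm (x - z) <= enorm (x - y) + enorm (y - z).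
Proof. by rewrite -[x - z](subrKA y); exact: enormD. Qed.

(** Limits and derivatives are taken in the sup norm, estimates in the Euclidean one; this bound and
    [enorm_le_normr] pass between them. *)
Lemma normr_le_enorm u : `|u| <= enorm u.
Proof.
rewrite -[`|u|]/(mx_norm u) mx_normrE; apply: bigmax_le; first exact: enorm_ge0.
by move=> [i j] _ /=; rewrite ord1; exact: coord_le_enorm.
Qed.

Lemma enorm_sqr_le_normr u : enorm u ^+ 2 <= d%:R * `|u| ^+ 2.
Proof.
rewrite enorm_sqr.
apply: (@le_trans _ _ (\sum_(i < d) `|u| ^+ 2)); last first.
  by rewrite sumr_const card_ord mulr_natl.
apply: ler_sum => i _; rewrite -real_normK ?num_real//.
rewrite ler_pXn2r// ?nnegrE//.
rewrite -[`|u|]/(mx_norm u) mx_normrE.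
exact: (le_bigmax _ (fun ij : 'I_1 * 'I_d => `|u ij.1 ij.2|) (ord0, i)).
Qed.

Lemma enorm_le_normr u : enorm u <= Num.sqrt d%:R * `|u|.
Proof.
rewrite -(@ler_pXn2r _ 2)// ?nnegrE ?mulr_ge0 ?sqrtr_ge0 ?enorm_ge0//.
by rewrite exprMn (sqr_sqrtr (ler0n _ _)) enorm_sqr_le_normr.
Qed.

Lemma open_enorm_ball (U : set 'rV[R]_d) z : open U -> U z ->
  exists2 r : R, 0 < r & forall y, enorm (y - z) <= r -> U y.
Proof.
move=> oU Uz; have /nbhs_ballP[r /= r0 rU] := open_nbhs_nbhs (conj oU Uz).
exists (r / 2) => [|y yz]; first by rewrite divr_gt0.
apply: rU; rewrite -ball_normE/= -normrN opprB.
apply: (le_lt_trans (normr_le_enorm _)); apply: (le_lt_trans yz).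
by rewrite ltr_pdivrMr// ltr_pMr// ltr1n.
Qed.

End EuclideanNorm.

(** * Strong convexity and minimizers *)

Section StrongConvexity.
Context {R : realType} {d : nat}.
Implicit Types (X : set 'rV[R]_d) (g : 'rV[R]_d -> R) (l sigma gamma t : R) (x y z : 'rV[R]_d).

(* A negative [l] expresses strong convexity with modulus [- l]. *)
Definition wconvex X l g := forall y z t, X y -> X z -> 0 < t -> t < 1 ->
  g (t *: y + (1 - t) *: z) <=
  t * g y + (1 - t) * g z + l / 2 * (t * (1 - t) * enorm (y - z) ^+ 2).

Lemma convex_set_comb X y z t : convex_set (X : set (convex_lmodType 'rV[R]_d)) ->
  X y -> X z -> 0 < t -> t < 1 -> X (t *: y + (1 - t) *: z).
Proof.
move=> cX Xy Xz t0 t1.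
have := cX y z (Itv01 (ltW t0) (ltW t1)); rewrite !inE => /(_ Xy Xz).
exact.
Qed.

Lemma weakly_convexP X l g : weakly_convex X l g -> wconvex X l g.
Proof.
move=> cg y z t Xy Xz t0 t1.
have := cg (Itv01 (ltW t0) (ltW t1)) y z; rewrite !inE => /(_ Xy Xz).
rewrite convRE /= /unstable.onem.
rewrite (_ : conv _ (y : convex_lmodType 'rV[R]_d) z = t *: y + (1 - t) *: z)//.
have := enorm_comb_sqr t 0 y z; rewrite !subr0 => ->.
set a := enorm y ^+ 2; set b := enorm z ^+ 2; set c := enorm (y - z) ^+ 2.
set u := g (_ + _); set v := g y; set w := g z.
lra.
Qed.

Lemma wconvexW X l l' g : l <= l' -> wconvex X l g -> wconvex X l' g.
Proof.
move=> ll' cg y z t Xy Xz t0 t1; apply: le_trans (cg _ _ _ Xy Xz t0 t1) _.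
rewrite lerD2l ler_wpM2r// ?ler_wpM2r//.
by rewrite mulr_ge0 ?sqr_ge0// mulr_ge0 ?subr_ge0// ltW.
Qed.

Lemma wconvexD_sqr X l gamma x g : wconvex X l g ->
  wconvex X (l - gamma) (fun y => g y + gamma / 2 * enorm (y - x) ^+ 2).
Proof.
move=> cg y z t Xy Xz t0 t1; have := cg _ _ _ Xy Xz t0 t1.
rewrite enorm_comb_sqr.
set a := enorm (y - x) ^+ 2; set b := enorm (z - x) ^+ 2.
set c := enorm (y - z) ^+ 2; set u := g (_ + _); set v := g y; set w := g z.
lra.
Qed.

Lemma wconvex_avg X l (m : nat) (g : 'I_m -> 'rV[R]_d -> R) : (0 < m)%N ->
  (forall i, wconvex X l (g i)) ->
  wconvex X l (fun y => m%:R^-1 * \sum_(i < m) g i y).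
Proof.
move=> m0 cg y z t Xy Xz t0 t1.
rewrite mulrCA [X in _ + X + _]mulrCA -mulrDr.
have -> : l / 2 * (t * (1 - t) * enorm (y - z) ^+ 2) = m%:R^-1 *
    \sum_(i < m) (l / 2 * (t * (1 - t) * enorm (y - z) ^+ 2)).
  by rewrite sumr_const card_ord -(mulr_natl (l / 2 * _)) mulKf// pnatr_eq0 -lt0n.
rewrite -mulrDr ler_wpM2l ?invr_ge0// !mulr_sumr -!big_split/=.
by apply: ler_sum => i _; exact: cg.
Qed.

(** Comparing [z] with a point at fraction [t] of the way to [y] and dividing by [t] gives the bound
    with an extra factor [1 - t], which tends to 1 as [t] tends to 0. *)
Lemma argmin_growth X sigma g z :
  convex_set (X : set (convex_lmodType 'rV[R]_d)) ->
  wconvex X (- sigma) g -> is_argmin X g z ->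
  forall y, X y -> g z + sigma / 2 * enorm (y - z) ^+ 2 <= g y.
Proof.
move=> cX cg [Xz zmin] y Xy; set n := enorm _ ^+ 2.
have n0 : 0 <= n by exact: sqr_ge0.
have key t : 0 < t -> t < 1 -> (1 - t) * (sigma / 2 * n) <= g y - g z.
  move=> t0 t1.
  have := le_trans (zmin _ (convex_set_comb cX Xy Xz t0 t1))
    (cg _ _ _ Xy Xz t0 t1).
  rewrite -/n => h.
  rewrite -(ler_pM2l t0); move: h; set a := g y; set b := g z => h; lra.
rewrite -lerBrDl; set a := sigma / 2 * n in key *; set b := g y - g z in key *.
(* A single [t] replaces the limit. If [b < a], then [t = 1 / 2] gives [a > 0], and
   [t = (a - b) / (2 a)] turns [(1 - t) a] into the midpoint of [a] and [b], which exceeds [b]. *)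
rewrite leNgt; apply/negP => ba.
have := key 2^-1; rewrite invr_gt0 ltr0n invf_lt1// ltr1n => /(_ isT isT) ab.
have a0 : 0 < a by lra.
have a20 : 0 < 2 * a by lra.
have t0 : 0 < (a - b) / (2 * a) by apply: divr_gt0 => //; lra.
have t1 : (a - b) / (2 * a) < 1.
  by rewrite ltr_pdivrMr// mul1r; lra.
have := key _ t0 t1.
have -> : (1 - (a - b) / (2 * a)) * a = (a + b) / 2.
  by field; rewrite gt_eqF.
lra.
Qed.

Lemma argmin_unique X sigma g z z' : 0 < sigma ->
  convex_set (X : set (convex_lmodType 'rV[R]_d)) ->
  wconvex X (- sigma) g -> is_argmin X g z -> is_argmin X g z' -> z = z'.
Proof.
move=> s0 cX cg mz mz'; apply/esym/eqP; rewrite -subr_eq0; apply/eqP.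
apply: enorm_eq0; apply/eqP; rewrite -sqrf_eq0 eq_le sqr_ge0 andbT.
have := argmin_growth cX cg mz mz'.1; have := mz'.2 _ mz.1 => h1 h2.
have : sigma / 2 * enorm (z' - z) ^+ 2 <= 0 by lra.
by rewrite pmulr_rle0// divr_gt0.
Qed.

(** Only one endpoint varies and only within distance 1, so that the notion survives adding a
    quadratic; a global Lipschitz bound would not. *)
Definition locally_lipschitz X g := forall z, X z ->
  exists2 A : R, 0 <= A & forall y, X y -> enorm (y - z) <= 1 ->
    `|g y - g z| <= A * enorm (y - z).

Lemma locally_lipschitzD_sqr X gamma x g : locally_lipschitz X g ->
  locally_lipschitz X (fun y => g y + gamma / 2 * enorm (y - x) ^+ 2).
Proof.
move=> lg z Xz; have [A A0 gA] := lg z Xz.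
exists (A + `|gamma / 2| * (1 + 2 * enorm (z - x))).
  by rewrite addr_ge0// mulr_ge0// addr_ge0// mulr_ge0// enorm_ge0.
move=> y Xy yz; have -> : y - x = (y - z) + (z - x) by rewrite subrKA.
rewrite enormD_sqr.
have -> : forall a b c e, g y + gamma / 2 * (a + b *+ 2 + c) - (e + gamma / 2 * c) =
   (g y - e) + gamma / 2 * (a + b *+ 2) by move=> *; ring.
apply: (le_trans (ler_normD _ _)); rewrite mulrDl lerD ?gA//.
rewrite normrM -mulrA ler_wpM2l//.
apply: (le_trans (ler_normD _ _)); rewrite mulrDl mul1r lerD//.
  rewrite ger0_norm ?sqr_ge0// expr2 ler_piMr ?enorm_ge0//.
rewrite normrMn -mulrA mulr_natl lerMn2r/= [leRHS]mulrC.
exact: norm_dot_le.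
Qed.

Lemma locally_lipschitz_avg X (m : nat) (g : 'I_m -> 'rV[R]_d -> R) (L : R) :
  (0 < m)%N ->
  (forall i y z, X y -> X z -> `|g i y - g i z| <= L * enorm (y - z)) ->
  0 <= L ->
  locally_lipschitz X (fun y => m%:R^-1 * \sum_(i < m) g i y).
Proof.
move=> m0 gL L0 z Xz; exists L => // y Xy _.
rewrite -mulrBr -sumrB normrM ger0_norm ?invr_ge0//.
rewrite ler_pdivrMl ?ltr0n//; apply: (le_trans (ler_norm_sum _ _ _)).
apply: (@le_trans _ _ (\sum_(i < m) (L * enorm (y - z)))).
  by apply: ler_sum => i _; exact: gL.
by rewrite sumr_const card_ord mulr_natl.
Qed.

(* A minimizing sequence is Cauchy, by strong convexity at midpoints. *)
Lemma argmin_exists X sigma g : X !=set0 -> closed X ->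
  convex_set (X : set (convex_lmodType 'rV[R]_d)) -> 0 < sigma ->
  wconvex X (- sigma) g -> locally_lipschitz X g -> has_lbound (g @` X) ->
  exists z, is_argmin X g z.
Proof.
move=> [x0 Xx0] clX cX s0 cg lg lb.
have hI : has_inf (g @` X) by split => //; exists (g x0); exists x0.
set I := inf (g @` X).
have Ile y : X y -> I <= g y by move=> Xy; apply: ge_inf => //; exists y.
have /choice[y_ yP] : forall n, exists y, X y /\ g y < I + n.+1%:R^-1.
  move=> n; have n0 : 0 < n.+1%:R^-1 :> R by rewrite invr_gt0.
  by have [_ [y Xy <-] yI] := inf_adherent n0 hI; exists y.
have mid n k : sigma / 4 * enorm (y_ n - y_ k) ^+ 2 <= n.+1%:R^-1 + k.+1%:R^-1.
  have [Xn gn] := yP n; have [Xk gk] := yP k.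
  have h0 : 0 < 2^-1 :> R by rewrite invr_gt0.
  have h1 : 2^-1 < 1 :> R by rewrite invf_lt1// ltr1n.
  have := le_trans (Ile _ (convex_set_comb cX Xn Xk h0 h1)) (cg _ _ _ Xn Xk h0 h1).
  move: gn gk; set a := g _; set b := g _; set c := _ ^+ 2.
  set e := n.+1%:R^-1; set f := k.+1%:R^-1; lra.
have cy : cauchy (y_ @ \oo).
  apply: cauchy_exP => e e0.
  (* Two such terms add up to [sigma / 4 * e ^+ 2], the bound under which [mid] forces a distance
     below [e]. *)
  have q0 : 0 < e ^+ 2 * sigma / 8 by rewrite !mulr_gt0.
  have [N _ NP] := near_infty_natSinv_lt (PosNum q0).
  exists (y_ N); exists N => // n /= Nn.
  rewrite -ball_normE/=; apply: (le_lt_trans (normr_le_enorm _)).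
  rewrite -(@ltr_pXn2r _ 2)// ?nnegrE ?enorm_ge0 ?ltW//.
  have := mid N n; have /= := NP N (leqnn N); have /= := NP n Nn.
  set a := enorm _ ^+ 2; set b := e ^+ 2.
  set f := n.+1%:R^-1; set f' := N.+1%:R^-1 => h1 h2 h3.
  rewrite -(ltr_pM2r s0); lra.
have [z yz] : exists z, y_ n @[n --> \oo] --> z.
  by exists (lim (y_ @ \oo)); exact: cauchy_cvg.
have Xz : X z.
  by apply: (closed_cvg X clX _ z yz); near=> n; exact: (yP n).1.
exists z; split => // y /Ile; apply: le_trans.
have [A A0 gA] := lg z Xz.
apply/ler_addgt0Pr => e e0.
set C := Num.sqrt d%:R : R.
have C0 : 0 <= C by exact: sqrtr_ge0.
(* The first entry brings [y_ n] into the unit ball where [gA] applies, the second makes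
   [A * enorm (y_ n - z)] at most [e / 2]; adding 1 keeps the denominators positive. *)
pose r := Num.min (1 / (C + 1)) (e / 2 / ((A + 1) * (C + 1))).
have r0 : 0 < r.
  by rewrite lt_min !divr_gt0 ?mulr_gt0// ltr_wpDl.
near \oo => n.
have nr : `|z - y_ n| <= r by near: n; move/cvgrPdist_le : yz; apply.
have ne : n.+1%:R^-1 < e / 2.
  by near: n; apply: (near_infty_natSinv_lt (PosNum (divr_gt0 e0 _))).
have nC : enorm (y_ n - z) <= C * r.
  rewrite enormB; apply: le_trans (enorm_le_normr _) _.
  by rewrite ler_wpM2l.
have n1 : enorm (y_ n - z) <= 1.
  apply: le_trans nC _; apply: (@le_trans _ _ (C * (1 / (C + 1)))).
    by rewrite ler_wpM2l// ge_min lexx.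
  by rewrite mul1r ler_pdivrMr ?ltr_wpDl// mul1r lerDl.
have nA : A * enorm (y_ n - z) <= e / 2.
  apply: (@le_trans _ _ ((A + 1) * ((C + 1) * (e / 2 / ((A + 1) * (C + 1)))))).
    apply: ler_pM => //; rewrite ?enorm_ge0 ?lerDl//.
    apply: le_trans nC _; apply: ler_pM; rewrite ?lerDl// ?(ltW r0)//.
    by rewrite /r ge_min lexx orbT.
  rewrite le_eqVlt; apply/orP; left; apply/eqP; field.
  by rewrite !gt_eqF// ltr_wpDl.
have [Xn gn] := yP n.
have := gA _ Xn n1; rewrite distrC ler_norml => /andP[_ h].
move: h gn ne nA; set a := g _; set b := g _; set c := n.+1%:R^-1; set f := A * _.
lra.
Unshelve. all: end_near. Qed.

End StrongConvexity.

(** * The Moreau envelope *)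

Section MoreauEnvelope.
Context {R : realType} {d : nat}.
Implicit Types (X : set 'rV[R]_d) (F g : 'rV[R]_d -> R) (x y z : 'rV[R]_d).

Lemma inf_argmin X g z : is_argmin X g z -> inf (g @` X) = g z.
Proof.
move=> [Xz zmin]; apply/eqP; rewrite eq_le; apply/andP; split.
  by apply: ge_inf; [exists (g z) => _ [y Xy <-]; exact: zmin|exists z].
by apply: lb_le_inf; [exists (g z); exists z|move=> _ [y Xy <-]; exact: zmin].
Qed.

Lemma has_lbound_prox X F rho x : 0 <= rho -> has_lbound (F @` X) ->
  has_lbound [set F y + rho / 2 * enorm (x - y) ^+ 2 | y in X].
Proof.
move=> rho0 [b lb]; exists b => _ [y Xy <-].
by apply: ler_wpDr; [rewrite mulr_ge0 ?divr_ge0 ?sqr_ge0|apply: lb; exists y].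
Qed.

Lemma moreau_le X F rho x y : 0 <= rho -> has_lbound (F @` X) -> X y ->
  moreau X F rho x <= F y + rho / 2 * enorm (x - y) ^+ 2.
Proof.
by move=> rho0 lb Xy; apply: ge_inf; [exact: has_lbound_prox|exists y].
Qed.

Lemma inf_le_moreau X F rho x : 0 <= rho -> has_lbound (F @` X) -> X !=set0 ->
  inf (F @` X) <= moreau X F rho x.
Proof.
move=> rho0 lb [y0 Xy0]; apply: lb_le_inf; first by eexists; exists y0.
move=> _ [y Xy <-]; apply: ler_wpDr; first by rewrite mulr_ge0 ?divr_ge0 ?sqr_ge0.
by apply: ge_inf => //; exists y.
Qed.

Lemma dot_is_linear (u : 'rV[R]_d) :
  linear (dot u : 'rV[R]_d -> R^o).
Proof.
move=> a v w; rewrite /dot scaler_sumr -big_split/=.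
apply: eq_bigr => i _; rewrite !mxE.
rewrite -[_ *: (_ : R^o)]/(a * (u ord0 i * v ord0 i)); ring.
Qed.

HB.instance Definition _ (u : 'rV[R]_d) :=
  GRing.isLinear.Build R 'rV[R]_d R^o *:%R (dot u) (dot_is_linear u).

Lemma dot_continuous (u : 'rV[R]_d) : continuous (dot u : 'rV[R]_d -> R^o).
Proof.
apply: (@continuous_big R^o) => /= [|i _]; first exact: add_continuous.
move=> v.
apply: (@continuous_comp _ _ _ (fun w : 'rV[R]_d => w ord0 i : R)
  ( *%R (u ord0 i))).
  exact: coord_continuous.
exact: mulrl_continuous.
Qed.

(* Quadratic growth at the proximal point [z] sandwiches the envelope at [x + h]
   between [M x + rho <x - z, h> - C |h|^2] and [M x + rho <x - z, h> + C |h|^2]. *)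
Lemma gradient_moreau X F rho sigma x z : 0 <= rho -> 0 < sigma ->
  has_lbound (F @` X) -> X z ->
  (forall y, X y -> F z + rho / 2 * enorm (x - z) ^+ 2 +
    sigma / 2 * enorm (y - z) ^+ 2 <= F y + rho / 2 * enorm (x - y) ^+ 2) ->
  gradient (moreau X F rho) x = rho *: (x - z).
Proof.
move=> rho0 s0 lb Xz grow.
have Mx : moreau X F rho x = F z + rho / 2 * enorm (x - z) ^+ 2.
  apply: inf_argmin; split => // y Xy; apply: le_trans (grow y Xy).
  by rewrite lerDl mulr_ge0 ?sqr_ge0// divr_ge0// ltW.
set df := dot (rho *: (x - z)).
(* The first summand is the upper error, from testing the envelope at [x + h] with [z]. The second
   is the lower error, what remains of [sigma / 2 |y - z|^2 - rho <y - z, h>] after completing the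
   square. *)
set C := rho / 2 + rho ^+ 2 / (2 * sigma).
have C0 : 0 <= C by rewrite addr_ge0 ?divr_ge0 ?sqr_ge0 ?mulr_ge0// ltW.
have dfE h : df h = rho * dot (x - z) h.
  by rewrite /df /dot mulr_sumr; apply: eq_bigr => i _; rewrite !mxE; ring.
have bnd h : `|moreau X F rho (h + x) - (moreau X F rho x + df h)| <=
    C * enorm h ^+ 2.
  have Q0 : 0 <= rho / 2 * enorm h ^+ 2 by rewrite mulr_ge0 ?divr_ge0 ?sqr_ge0.
  have Q1 : 0 <= rho ^+ 2 / (2 * sigma) * enorm h ^+ 2.
    by rewrite mulr_ge0 ?sqr_ge0// divr_ge0 ?sqr_ge0// mulr_ge0// ltW.
  have shiftE y : enorm (h + x - y) ^+ 2 =
      enorm (x - y) ^+ 2 + 2 * dot (x - y) h + enorm h ^+ 2.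
    have -> : h + x - y = (x - y) + h by rewrite -addrA addrC.
    by rewrite enormD_sqr (mulr_natl (dot _ _) 2).
  rewrite /C mulrDl ler_norml; apply/andP; split.
    rewrite lerBrDr; apply: lb_le_inf; first by eexists; exists z.
    move=> _ [y Xy <-]; rewrite shiftE Mx dfE.
    have dE : dot (x - y) h = dot (x - z) h - dot (y - z) h.
      by rewrite /dot -sumrB; apply: eq_bigr => i _; rewrite !mxE; ring.
    have sq : 0 <= enorm (sigma *: (y - z) - rho *: h) ^+ 2 by exact: sqr_ge0.
    have sqE : enorm (sigma *: (y - z) - rho *: h) ^+ 2 = 2 * sigma *
        (sigma / 2 * enorm (y - z) ^+ 2 - rho * dot (y - z) h
         + rho ^+ 2 / (2 * sigma) * enorm h ^+ 2).
      rewrite [LHS]enormD_sqr enormN !enormZ !exprMn !real_normK ?num_real//.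
      have -> : dot (sigma *: (y - z)) (- (rho *: h)) =
          - (sigma * rho * dot (y - z) h).
        rewrite /dot mulr_sumr -sumrN; apply: eq_bigr => i _.
        by rewrite !mxE; ring.
      by field; rewrite gt_eqF.
    rewrite sqE pmulr_rge0 ?mulr_gt0// in sq.
    have := grow y Xy; rewrite dE; move: sq Q0.
    set a := enorm (x - y) ^+ 2; set b := enorm (y - z) ^+ 2.
    set e := enorm h ^+ 2; set f := dot (x - z) h; set k := dot (y - z) h.
    set n := enorm (x - z) ^+ 2; set q := rho ^+ 2 / (2 * sigma) * e; lra.
  rewrite lerBlDr; apply: le_trans (moreau_le _ _ lb Xz) _ => //.
  rewrite shiftE Mx dfE; move: Q1.
  set a := enorm (x - z) ^+ 2; set e := enorm h ^+ 2; set f := dot _ _.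
  set q := rho ^+ 2 / (2 * sigma) * e; lra.
have dE : 'd (moreau X F rho : 'rV[R]_d -> R^o) x = df :> ('rV[R]_d -> R^o).
  apply: (@diff_unique _ _ _ _ (dot (rho *: (x - z)) : {linear 'rV[R]_d -> R^o})).
    exact: dot_continuous.
  apply/eqaddoP => e e0.
  have Cd0 : 0 < C * d%:R + 1 by rewrite ltr_wpDl// mulr_ge0.
  have er0 : 0 < e / (C * d%:R + 1) by rewrite divr_gt0.
  apply/nbhs_ballP; exists (e / (C * d%:R + 1)) => //= h.
  rewrite -ball_normE/= sub0r normrN => hr.
  apply: le_trans (bnd h) _.
  apply: (@le_trans _ _ (C * (d%:R * `|h| ^+ 2))).
    by rewrite ler_wpM2l// enorm_sqr_le_normr.
  rewrite expr2 !mulrA ler_wpM2r//.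
  apply: (@le_trans _ _ ((C * d%:R + 1) * (e / (C * d%:R + 1)))).
    by apply: ler_pM; rewrite ?mulr_ge0 ?lerDl// ltW.
  by rewrite mulrCA divff ?mulr1// gt_eqF.
apply/rowP => i; rewrite mxE dE /df /dot (bigD1 i)//= big1 => [|j ji].
  by rewrite !mxE !eqxx mulr1 addr0.
by rewrite !mxE (negbTE ji) andbF mulr0.
Qed.

End MoreauEnvelope.

(** * Measurable dependence of minimizers *)

Section MeasurableArgmin.
Context {R : realType} {d : nat}.
Implicit Types (X : set 'rV[R]_d).

Lemma rat_vector_dense (y : 'rV[R]_d) (r : R) : 0 < r ->
  exists q : 'rV[rat]_d, enorm (y - map_mx ratr q) <= r.
Proof.
move=> r0; set C := Num.sqrt d%:R + 1 : R.
have C0 : 0 < C by rewrite ltr_wpDl// sqrtr_ge0.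
have rC0 : 0 < r / C by rewrite divr_gt0.
have /choice[q qP] : forall i : 'I_d, exists q : rat, `|y ord0 i - ratr q| <= r / C.
  move=> i; have [|q] := @rat_in_itvoo R (y ord0 i) (y ord0 i + r / C).
    by rewrite ltrDl.
  rewrite in_itv/= => /andP[q1 q2]; exists q.
  by rewrite ler_distlC; apply/andP; split; lra.
exists (\row_i q i); apply: le_trans (enorm_le_normr _) _.
apply: (@le_trans _ _ (C * (r / C))); last by rewrite mulrCA divff ?mulr1// gt_eqF.
apply: ler_pM; rewrite ?sqrtr_ge0 ?lerDl//.
rewrite -[`|_|]/(mx_norm _) mx_normrE; apply: bigmax_le; first exact: ltW.
by move=> [i j] _ /=; rewrite ord1 !mxE.
Qed.

(** [X] need not contain rational points. For every rational centre and every radius [1 / (n + 1)],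
    a point of [X] in that ball is picked if there is one, and [y0] otherwise. *)
Lemma dense_sequence X : X !=set0 -> exists D : nat -> 'rV[R]_d,
  (forall n, X (D n)) /\
  forall y r, X y -> 0 < r -> exists n, enorm (D n - y) <= r.
Proof.
move=> [y0 Xy0].
have /choice[D DP] : forall qn : 'rV[rat]_d * nat, exists u, X u /\
    forall y, X y -> enorm (y - map_mx ratr qn.1) <= qn.2.+1%:R^-1 ->
      enorm (u - map_mx ratr qn.1) <= qn.2.+1%:R^-1.
  move=> qn; have [[u [Xu uq]]|nu] := pselect (exists u, X u /\
      enorm (u - map_mx ratr qn.1) <= qn.2.+1%:R^-1); first by exists u.
  by exists y0; split => // y Xy yq; exfalso; apply: nu; exists y.
exists (fun n => D (odflt (0, 0%N) (unpickle n))); split => [n|y r Xy r0].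
  by have [] := DP (odflt (0, 0%N) (unpickle n)).
have r20 : 0 < r / 2 by rewrite divr_gt0.
have [n _ /(_ n (leqnn n))/= nr] := near_infty_natSinv_lt (PosNum r20).
have [|q yq] := @rat_vector_dense y n.+1%:R^-1; first by rewrite invr_gt0.
exists (pickle (q, n)); rewrite pickleK/=.
have [_ /(_ y Xy yq) uq] := DP (q, n).
apply: le_trans (enorm_triangle _ (map_mx ratr q) _) _.
rewrite [enorm (_ - y)]enormB (splitr r) lerD//.
  exact: le_trans uq (ltW nr).
exact: le_trans yq (ltW nr).
Qed.

(* By quadratic growth the argmin lies in an open [U] iff, for some point [a] of a
   countable dense set and some ball of radius [r] around [a] contained in [U], the
   value at [a] exceeds the values on the dense set by at most [sigma / 2 r^2]. *)
Lemma measurable_argmin (dT : measure_display) (T : measurableType dT) X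
    (sigma : R) (Phi : T -> 'rV[R]_d -> R) (z : T -> 'rV[R]_d) :
  0 < sigma -> convex_set (X : set (convex_lmodType 'rV[R]_d)) ->
  (forall y, X y -> measurable_fun [set: T] (Phi ^~ y)) ->
  (forall w, wconvex X (- sigma) (Phi w)) ->
  (forall w, locally_lipschitz X (Phi w)) ->
  (forall w, is_argmin X (Phi w) (z w)) ->
  measurable_fun [set: T] (z : T -> borel_rV R d).
Proof.
move=> s0 cX mPhi cPhi lPhi zP.
have [D [XD dD]] : exists D : nat -> 'rV[R]_d, (forall n, X (D n)) /\
    forall y r, X y -> 0 < r -> exists n, enorm (D n - y) <= r.
  by apply: dense_sequence; exists (z point); have [] := zP point.
have near_z w (e r : R) : 0 < e -> 0 < r ->
    exists n, enorm (D n - z w) <= r /\ Phi w (D n) <= Phi w (z w) + e.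
  move=> e0 r0; have [Xz _] := zP w; have [A A0 PhiA] := lPhi w _ Xz.
  have A1 : 0 < A + 1 by rewrite ltr_wpDl.
  have m0 : 0 < Num.min r (Num.min 1 (e / (A + 1))).
    by rewrite !lt_min r0 ltr01 divr_gt0.
  have [n] := dD _ _ Xz m0; rewrite !le_min => /and3P[nr n1 ne].
  exists n; split => //; have := PhiA _ (XD n) n1.
  rewrite ler_norml => /andP[_]; rewrite lerBlDl => /le_trans; apply.
  rewrite lerD2l; rewrite ler_pdivlMr// in ne.
  by apply: le_trans ne; rewrite mulrC ler_wpM2l ?enorm_ge0// lerDl.
apply: (@measurability _ _ _ (borel_rV R d) setT z (@open 'rV[R]_d) erefl)
  => _ [U oU <-]; rewrite setTI.
pose r (k : nat) : R := k.+1%:R^-1.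
have r0 k : 0 < r k by rewrite invr_gt0.
pose tol k := sigma / 2 * r k ^+ 2.
have tol0 k : 0 < tol k by rewrite mulr_gt0 ?divr_gt0 ?exprn_gt0.
have -> : z @^-1` U = \bigcup_n
   \bigcup_(k in [set k | forall y, enorm (y - D n) <= r k -> U y])
      \bigcap_j [set w | Phi w (D n) <= Phi w (D j) + tol k].
  apply/seteqP; split => [w /= Uz|w [n _ [k /= rU near_min]]].
    have [e e0 eU] := open_enorm_ball oU Uz.
    have e20 : 0 < e / 2 by rewrite divr_gt0.
    have [k _ /(_ k (leqnn k))/= ke] := near_infty_natSinv_lt (PosNum e20).
    have [n [ne nPhi]] := near_z w _ _ (tol0 k) e20.
    exists n => //; exists k => /= [y yn|j _ /=].
      apply: eU; apply: le_trans (enorm_triangle _ (D n) _) _.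
      by rewrite (splitr e) lerD// (le_trans yn)// ltW.
    by apply: (le_trans nPhi); rewrite lerD2r; exact: (zP w).2.
  apply: rU; rewrite enormB.
  rewrite -(@ler_pXn2r _ 2)// ?nnegrE ?enorm_ge0 ?(ltW (r0 k))//.
  have s20 : 0 < sigma / 2 by rewrite divr_gt0.
  rewrite -(ler_pM2l s20) -/(tol k).
  rewrite -(lerD2l (Phi w (z w))).
  apply: le_trans (argmin_growth cX (cPhi w) (zP w) (XD n)) _.
  (* Testing [D n] against the dense points alone suffices: by [near_z] their values come within any
     [e] of the minimum. *)
  apply/ler_addgt0Pr => e e0.
  have [j [_ jPhi]] := near_z w _ _ e0 ltr01.
  apply: le_trans (near_min j I) _.
  by rewrite addrAC lerD2r.
apply: bigcup_measurable => n _; apply: bigcup_measurable => k _.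
apply: bigcapT_measurable => j; rewrite -[X in measurable X]setTI.
apply: measurable_fun_le => //; first exact: mPhi.
by apply: measurable_funD => //; exact: mPhi.
Qed.

End MeasurableArgmin.

(** * Integrals of bounded measurable functions *)

Section BoundedMeasurable.
Context {R : realType}.

(** The bound holds at every point rather than almost everywhere, so it passes to compositions and
    slices, and it gives integrability for every probability at once. *)
Definition bounded_measurable (dT : measure_display) (T : measurableType dT)
    (g : T -> R) :=
  measurable_fun [set: T] g /\ exists M : R, forall w, `|g w| <= M.

Section Algebra.
Context (dT : measure_display) (T : measurableType dT).
Implicit Types g h : T -> R.

Lemma bounded_measurable_cst (c : R) : bounded_measurable (fun _ : T => c).
Proof. by split; [exact: measurable_cst|exists `|c|]. Qed.

Lemma bounded_measurableD g h : bounded_measurable g -> bounded_measurable h ->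
  bounded_measurable (fun w => g w + h w).
Proof.
move=> [mg [M gM]] [mh [N hN]]; split; first exact: measurable_funD.
by exists (M + N) => w; rewrite (le_trans (ler_normD _ _))// lerD.
Qed.

Lemma bounded_measurableZ (c : R) g : bounded_measurable g ->
  bounded_measurable (fun w => c * g w).
Proof.
move=> [mg [M gM]]; split; first exact: measurable_funM.
by exists (`|c| * M) => w; rewrite normrM ler_wpM2l.
Qed.

Lemma bounded_measurableB g h : bounded_measurable g -> bounded_measurable h ->
  bounded_measurable (fun w => g w - h w).
Proof.
move=> [mg [M gM]] [mh [N hN]]; split; first exact: measurable_funB.
by exists (M + N) => w; rewrite (le_trans (ler_normB _ _))// lerD.
Qed.

Lemma bounded_measurable_sum (I : Type) (r : seq I) (g : I -> T -> R) :
  (forall i, bounded_measurable (g i)) ->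
  bounded_measurable (fun w => \sum_(i <- r) g i w).
Proof.
move=> bg; elim: r => [|i r IH].
  by under eq_fun do rewrite big_nil; exact: bounded_measurable_cst.
by under eq_fun do rewrite big_cons; exact: bounded_measurableD.
Qed.

Lemma bounded_measurable_integrable (P : probability T R) g :
  bounded_measurable g -> P.-integrable [set: T] (EFin \o g).
Proof.
move=> [mg [M gM]]; apply: measurable_bounded_integrable => //.
  by rewrite /= probability_setT ltry.
by exists M; split; [exact: num_real|move=> N MN w _; exact: le_trans (gM w) (ltW MN)].
Qed.

Lemma Rintegral_sum (P : probability T R) (I : Type) (r : seq I) (g : I -> T -> R) :
  (forall i, bounded_measurable (g i)) ->
  \int[P]_w (\sum_(i <- r) g i w) = \sum_(i <- r) \int[P]_w g i w.
Proof.
move=> bg; elim: r => [|i r IH].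
  under eq_Rintegral do rewrite big_nil.
  by rewrite Rintegral_cst// big_nil mul0r.
under eq_Rintegral do rewrite big_cons.
rewrite RintegralD//= ?big_cons ?IH//; apply: bounded_measurable_integrable => //.
exact: bounded_measurable_sum.
Qed.

Lemma Rintegral_prob_cst (P : probability T R) (c : R) : \int[P]_w c = c.
Proof. rewrite Rintegral_cst//.
by rewrite [X in fine X](_ : _ = 1%E) ?mulr1//; exact: probability_setT. Qed.

Lemma le_Rintegral_bounded (P : probability T R) g h : bounded_measurable g ->
  bounded_measurable h -> (forall w, g w <= h w) ->
  \int[P]_w g w <= \int[P]_w h w.
Proof.
by move=> bg bh gh; apply: le_Rintegral => //; exact: bounded_measurable_integrable.
Qed.

Lemma expectation_bounded (P : probability T R) g : bounded_measurable g ->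
  'E_P[g]%E = (\int[P]_w g w)%:E.
Proof.
move=> bg; rewrite unlock /Rintegral fineK//.
by apply: integrable_fin_num => //; exact: bounded_measurable_integrable.
Qed.

End Algebra.

Lemma bounded_measurable_comp (d1 d2 : measure_display) (T1 : measurableType d1)
    (T2 : measurableType d2) (h : T1 -> T2) (g : T2 -> R) :
  measurable_fun [set: T1] h -> bounded_measurable g ->
  bounded_measurable (fun w => g (h w)).
Proof.
move=> mh [mg [M gM]]; split; last by exists M => w.
exact: measurableT_comp mg mh.
Qed.

(** * Iterated integrals of bounded real functions *)

Section FubiniBounded.
Context (d1 d2 : measure_display) (T1 : measurableType d1) (T2 : measurableType d2).
Context (P1 : probability T1 R) (P2 : probability T2 R).
Context (H : T1 * T2 -> R).
Hypothesis bH : bounded_measurable H.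

Lemma bounded_measurable_slice x : bounded_measurable (fun y => H (x, y)).
Proof. exact: (bounded_measurable_comp (measurable_pair1 x) bH). Qed.

Let iH : (P1 \x P2)%E.-integrable setT (EFin \o H).
Proof. exact: (@bounded_measurable_integrable _ _ (P1 \x P2)%E). Qed.

Lemma fubini_F_bounded :
  fubini_F P2 (EFin \o H) = (fun x => (\int[P2]_y H (x, y))%:E).
Proof.
apply/funext => x; rewrite /fubini_F /Rintegral fineK//.
apply: integrable_fin_num => //.
exact: bounded_measurable_integrable (bounded_measurable_slice x).
Qed.

Lemma bounded_measurable_Rintegral :
  bounded_measurable (fun x => \int[P2]_y H (x, y)).
Proof.
split.
  apply/measurable_EFinP; rewrite (_ : EFin \o _ = fubini_F P2 (EFin \o H)).
    exact: measurable_fubini_F iH.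
  by rewrite fubini_F_bounded.
have [mH [M HM]] := bH; exists M => x.
have sl := bounded_measurable_slice x.
rewrite ler_norml; apply/andP; split.
  rewrite -[leLHS](Rintegral_prob_cst P2); apply: le_Rintegral_bounded => // [|y].
    exact: bounded_measurable_cst.
  by have := HM (x, y); rewrite ler_norml => /andP[].
rewrite -[leRHS](Rintegral_prob_cst P2); apply: le_Rintegral_bounded => // [|y].
  exact: bounded_measurable_cst.
by have := HM (x, y); rewrite ler_norml => /andP[].
Qed.

Lemma integral_prod_bounded :
  (\int[P1 \x P2]_z (H z)%:E)%E = (\int[P1]_x \int[P2]_y H (x, y))%:E.
Proof.
rewrite -(integral12_prod_meas1 iH) fubini_F_bounded.
rewrite /Rintegral fineK//; apply: integrable_fin_num => //.
exact: bounded_measurable_integrable bounded_measurable_Rintegral.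
Qed.

End FubiniBounded.

Lemma Rintegral_Fubini (d1 d2 : measure_display) (T1 : measurableType d1)
    (T2 : measurableType d2) (P1 : probability T1 R) (P2 : probability T2 R)
    (H : T1 * T2 -> R) : bounded_measurable H ->
  \int[P1]_x \int[P2]_y H (x, y) = \int[P2]_y \int[P1]_x H (x, y).
Proof.
move=> bH; have iH : (P1 \x P2)%E.-integrable setT (EFin \o H).
  exact: (@bounded_measurable_integrable _ _ (P1 \x P2)%E).
have bH' : bounded_measurable (fun z : T2 * T1 => H (z.2, z.1)).
  apply: (bounded_measurable_comp (h := fun z : T2 * T1 => (z.2, z.1)) _ bH).
  exact: measurable_swap.
have := Fubini iH.
rewrite -[LHS]/(\int[P1]_x fubini_F P2 (EFin \o H) x)%E fubini_F_bounded//.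
rewrite -[RHS]/(\int[P2]_x fubini_F P1 (EFin \o (fun z => H (z.2, z.1))) x)%E.
by rewrite fubini_F_bounded// => h; rewrite /Rintegral h.
Qed.

(** * Integrating out an independent variable *)

Section Freezing.
Context (dO dT dS : measure_display) (Omega : measurableType dO)
  (T : measurableType dT) (S : measurableType dS).
Context (P : probability Omega R) (Q : probability S R).
Context (W : Omega -> T) (Z : Omega -> S).
Hypotheses (mW : measurable_fun [set: Omega] W) (mZ : measurable_fun [set: Omega] Z).
Hypothesis indep : forall A B, measurable A -> measurable B ->
  P (W @^-1` A `&` Z @^-1` B) = (P (W @^-1` A) * Q B)%E.

(* Fubini, since [(W, Z)] has law [law W \x Q]. *)
Lemma Rintegral_freeze (H : T * S -> R) : bounded_measurable H ->
  \int[P]_w H (W w, Z w) = \int[P]_w \int[Q]_s H (W w, s).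
Proof.
move=> bH.
have mWZ : measurable_fun [set: Omega] (fun w => (W w, Z w)).
  exact: measurable_fun_pair.
pose WZ : {RV P >-> (T * S)%type} := mfun_Sub (mem_set mWZ).
pose Wm : {RV P >-> T} := mfun_Sub (mem_set mW).
(* Rectangles determine the product measure, and on rectangles the claim is [indep]. *)
have lawE A : measurable A -> distribution P WZ A = (distribution P Wm \x Q)%E A.
  move=> mA; apply/esym/product_measure_unique; last exact: mA.
  move=> B C mB mC.
  exact: indep.
have mH : measurable_fun setT (EFin \o H) by apply/measurable_EFinP; case: bH.
rewrite {1}/Rintegral.
transitivity (fine (\int[distribution P WZ]_z (H z)%:E)).
  congr fine; rewrite integral_distribution//.
  apply: bounded_measurable_integrable; exact: bounded_measurable_comp mWZ bH.
rewrite (eq_measure_integral (distribution P Wm \x Q)%E) => [|A mA _]; last first.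
  exact: lawE.
rewrite integral_prod_bounded//= /Rintegral.
congr fine; rewrite integral_distribution//.
  by apply/measurable_EFinP; case: (bounded_measurable_Rintegral (distribution P Wm) Q bH).
apply: bounded_measurable_integrable.
exact: bounded_measurable_comp mW (bounded_measurable_Rintegral (distribution P Wm) Q bH).
Qed.

End Freezing.
End BoundedMeasurable.

(** * Independence *)

Section Independence.
Context {R : realType} (dO dS : measure_display) (Omega : measurableType dO)
  (S : measurableType dS) (P : probability Omega R).

(** With the identity map as the random variable carrying the information in [Y], the iterates
    remain functions on [Omega] and need not be factored through a product of copies of [S]. *)
Definition generated_space (I : Type) (Y : I -> {RV P >-> S}) :=
  g_sigma_algebraType
    (\bigcup_i preimage_set_system [set: Omega] (Y i) (@measurable _ S)).

Lemma generated_sigma_algebra_sub (I : Type) (Y : I -> {RV P >-> S}) :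
  generated_sigma_algebra Y `<=` @measurable _ Omega.
Proof.
apply: smallest_sub; first exact: sigma_algebra_measurable.
by move=> _ [i _ [B mB <-]]; exact: (measurable_funPT (Y i) measurableT B mB).
Qed.

Lemma measurable_generated_id (I : Type) (Y : I -> {RV P >-> S}) :
  measurable_fun [set: Omega] (id : Omega -> generated_space Y).
Proof. by move=> _ A mA; rewrite setTI; exact: (generated_sigma_algebra_sub mA). Qed.

Lemma measurable_generated_coord (I : Type) (Y : I -> {RV P >-> S}) i :
  measurable_fun [set: generated_space Y] (Y i : generated_space Y -> S).
Proof.
move=> _ B mB; apply: sub_sigma_algebra; exists i => //.
by exists B.
Qed.

(** A pi-system argument: both sides are finite measures in [A], and cylinders over the indices
    other than [i0] are stable under intersection and generate the sigma-algebra. *)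
Lemma mutually_independent_others (I : finType) (Y : I -> {RV P >-> S}) (i0 : I)
    (Y' := fun j : {j | j != i0} => Y (val j)) (A : set Omega) (B : set S) :
  mutually_independent Y -> generated_sigma_algebra Y' A -> measurable B ->
  P (A `&` Y i0 @^-1` B) = (P A * P (Y i0 @^-1` B))%E.
Proof.
move=> indep GA mB.
have mpre i C : measurable C -> measurable (Y i @^-1` C).
  by move=> mC; rewrite -[X in measurable X]setTI; exact: (measurable_funPT (Y i) measurableT C mC).
pose cyl (C : I -> set S) := \bigcap_(i in [set` [set j | j != i0]%SET]) Y i @^-1` C i.
pose G : set (set Omega) :=
  [set cyl C | C in [set C | forall i, measurable (C i)]].
have Gm : G `<=` measurable.
  move=> _ [C mC <-]; apply: fin_bigcap_measurable; first exact: finite_finset.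
  by move=> i _; exact: mpre.
have GT : G setT.
  exists (fun=> setT) => [i|]; first exact: measurableT.
  by rewrite -subTset => w _ i _.
have GI : setI_closed G.
  move=> _ _ [C mC <-] [D mD <-]; exists (fun i => C i `&` D i).
    by move=> i; exact: measurableI.
  by rewrite /cyl -bigcapI.
have mE := mpre i0 B mB.
have Efin : P (Y i0 @^-1` B) \is a fin_num by exact: fin_num_measure.
have E0 : 0 <= fine (P (Y i0 @^-1` B)) by rewrite fine_ge0.
have key : forall A, <<s G >> A -> mrestr P mE A = mscale (NngNum E0) P A.
  apply: (@g_sigma_algebra_measure_unique _ _ _ G Gm (fun=> setT)) => //.
  - by apply/seteqP; split => // w _; exists 0%N.
  - move=> _ [C mC <-]; rewrite /= /mrestr /mscale/= fineK//.
    have mCB i : measurable (if i == i0 then B else C i) by case: ifP.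
    (* The intersection is a cylinder over all indices. Independence is then used twice, for the
       full index set and for the indices other than [i0]. *)
    have -> : cyl C `&` Y i0 @^-1` B =
        \bigcap_(i in [set` [set: I]%SET]) Y i @^-1` (if i == i0 then B else C i).
      apply/seteqP; split => [w [Cw Bw] i _ /=|w Cw]; last first.
        split; last by have := Cw i0; rewrite /= eqxx; apply; rewrite inE.
        move=> i /=; rewrite !inE => ii0; have := Cw i.
        by rewrite /= (negbTE ii0); apply; rewrite inE.
      by case: eqVneq => [->//|ii0]; apply: Cw; rewrite /= !inE.
    rewrite indep// (bigD1 i0)//= eqxx; congr (_ * _)%E.
    rewrite /cyl indep//; apply: eq_big => [i|i]; first by rewrite !inE.
    by rewrite !inE /= => /negbTE ->.
  - by move=> _; rewrite /= /mrestr setTI ltey_eq fin_num_measure.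
have GA' : <<s G >> A.
  apply: GA; split; first exact: smallest_sigma_algebra.
  move=> _ [[i ii0] _ [C mC <-]]; apply: sub_sigma_algebra.
  exists (fun j => if j == i then C else setT).
    by move=> j; case: ifP.
  rewrite setTI /cyl; apply/seteqP; split => [w /(_ i)|w Cw j _].
    by rewrite /= !inE eqxx; apply.
  by rewrite /=; case: eqP => [->|].
have := key A GA'; rewrite /mrestr /mscale/= fineK// => ->.
by rewrite muleC.
Qed.

(** The indicator of [C] is read as a boolean random variable independent of [W], so freezing [W]
    replaces it by its mean. This is what decouples the random index from the iterates. *)
Lemma Rintegral_indep_event (dT : measure_display) (T : measurableType dT)
    (W : Omega -> T) (C : set Omega) (g : T -> R) :
  measurable_fun [set: Omega] W -> measurable C ->
  (forall A, measurable A -> P (C `&` W @^-1` A) = (P C * P (W @^-1` A))%E) ->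
  bounded_measurable g ->
  \int[P]_w ((w \in C)%:R * g (W w)) = fine (P C) * \int[P]_w g (W w).
Proof.
move=> mW mC indep bg.
pose Z (w : Omega) : bool := w \in C.
have ZC : Z @^-1` [set true] = C.
  by apply/seteqP; split => w /=; rewrite /Z; [move/set_mem|move/mem_set].
have mZ : measurable_fun [set: Omega] Z.
  by apply: (measurable_fun_bool true); rewrite setTI ZC.
pose Zm : {RV P >-> bool} := mfun_Sub (mem_set mZ).
have mWA A : measurable A -> measurable (W @^-1` A).
  by move=> mA; rewrite -[X in measurable X]setTI; exact: mW.
have bnat : bounded_measurable (fun b : bool => b%:R : R).
  split; last by exists 1 => -[]; rewrite /= ?normr0 ?normr1.
  by move=> _ B mB.
have intZ : \int[distribution P Zm]_b b%:R = fine (P C).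
  have iZ : P.-integrable setT ((EFin \o (fun b : bool => b%:R)) \o Zm).
    exact: (bounded_measurable_integrable P (bounded_measurable_comp mZ bnat)).
  have mb : measurable_fun setT (EFin \o (fun b : bool => b%:R : R)).
    by apply/measurable_EFinP; case: bnat.
  rewrite /Rintegral (integral_distribution mb iZ).
  by congr fine; rewrite -[in RHS](setIT C) -integral_indic.
have indep' A B : measurable A -> measurable B ->
    P (W @^-1` A `&` Z @^-1` B) = (P (W @^-1` A) * distribution P Zm B)%E.
  move=> mA _; rewrite /distribution /pushforward/=.
  have CA : P (W @^-1` A `&` C) = (P (W @^-1` A) * P C)%E.
    by rewrite setIC indep// muleC.
  (* Independence is known for the event [true] only; the other three subsets of [bool] follow by
     complement and trivially. *)
  have [Bt|Bt] := pselect (B true); have [Bf|Bf] := pselect (B false).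
  - have -> : Z @^-1` B = setT.
      by apply/seteqP; split => // w _ /=; case: (Z w).
    by rewrite setIT [X in (_ * X)%E](_ : _ = 1%E) ?mule1//; exact: probability_setT.
  - suff -> : Z @^-1` B = C by [].
    rewrite -ZC; apply/seteqP; split => w /=; first by case: (Z w).
    by move=> ->.
  - have -> : Z @^-1` B = ~` C.
      by rewrite -ZC; apply/seteqP; split => w /=; case: (Z w).
    have PD : P (W @^-1` A `\` C) = (P (W @^-1` A) - P (W @^-1` A `&` C))%E.
      apply: measureD => //; first exact: mWA.
      by rewrite ltey_eq fin_num_measure//; exact: mWA.
    rewrite [X in (_ * X)%E]probability_setC// -setDE PD.
    rewrite CA muleBr ?mule1//; first by rewrite fin_num_measure//; exact: mWA.
  - have -> : Z @^-1` B = set0.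
      by apply/seteqP; split => // w /=; case: (Z w).
    by rewrite setI0 !measure0 mule0.
have bH : bounded_measurable (fun z : T * bool => z.2%:R * g z.1).
  have [mb [M1 b1]] := bnat; have [mg [M2 g2]] := bg; split.
    apply: measurable_funM; first exact: (measurableT_comp mb measurable_snd).
    exact: (measurableT_comp mg measurable_fst).
  exists (M1 * M2) => z; rewrite normrM; exact: ler_pM.
rewrite (Rintegral_freeze mW mZ indep' bH)/=.
have ibn : (distribution P Zm).-integrable setT (EFin \o (fun b : bool => b%:R)).
  exact: bounded_measurable_integrable.
under eq_Rintegral => w _ do rewrite (RintegralZr _ measurableT ibn) intZ.
rewrite RintegralZl//.
exact: bounded_measurable_integrable (bounded_measurable_comp mW bg).
Qed.

End Independence.

(** * Stability and generalization *)

Section ReplaceOne.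
Context {R : realType} (dO dT dS : measure_display) (Omega : measurableType dO)
  (T : measurableType dT) (S : measurableType dS).
Context (P : probability Omega R) (Q : probability S R).
Context (W : Omega -> T) (Z : Omega -> S).
Hypotheses (mW : measurable_fun [set: Omega] W) (mZ : measurable_fun [set: Omega] Z).
Hypothesis indep : forall A B, measurable A -> measurable B ->
  P (W @^-1` A `&` Z @^-1` B) = (P (W @^-1` A) * Q B)%E.

(* [D t s s'] is a loss on the test sample [s'] after training on [s]; by Fubini the
   ghost sample may be exchanged with the training sample. *)
Lemma generalization_gap (D : T -> S -> S -> R) (eps : R) :
  bounded_measurable (fun z : (T * S) * S => D z.1.1 z.1.2 z.2) ->
  (forall t s s', D t s s - D t s' s <= eps) ->
  bounded_measurable (fun w => D (W w) (Z w) (Z w) - \int[Q]_s D (W w) (Z w) s) /\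
  \int[P]_w (D (W w) (Z w) (Z w) - \int[Q]_s D (W w) (Z w) s) <= eps.
Proof.
move=> bD stab.
pose Wm : {RV P >-> T} := mfun_Sub (mem_set mW).
pose H (z : T * S) := D z.1 z.2 z.2 - \int[Q]_s D z.1 z.2 s.
have bdiag : bounded_measurable (fun z : T * S => D z.1 z.2 z.2).
  apply: (bounded_measurable_comp (h := fun z : T * S => (z, z.2)) _ bD).
  by apply: measurable_fun_pair => //; exact: measurable_snd.
have bint := bounded_measurable_Rintegral (distribution P Wm \x Q)%E Q bD.
have bH : bounded_measurable H by exact: bounded_measurableB bdiag bint.
have mWZ : measurable_fun [set: Omega] (fun w => (W w, Z w)).
  exact: measurable_fun_pair.
split; first exact: bounded_measurable_comp mWZ bH.
rewrite (Rintegral_freeze mW mZ indep bH).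
rewrite -[leRHS](Rintegral_prob_cst P); apply: le_Rintegral_bounded.
- apply: (bounded_measurable_comp (g := fun t => \int[Q]_s H (t, s)) mW).
  exact: (bounded_measurable_Rintegral (distribution P Wm) Q bH).
- exact: bounded_measurable_cst.
move=> w; set t := W w.
have mt : measurable_fun setT (fun z : S * S => ((t, z.1), z.2)).
  apply: measurable_fun_pair; last exact: measurable_snd.
  by apply: measurable_fun_pair; [exact: measurable_cst|exact: measurable_fst].
have bDt : bounded_measurable (fun z : S * S => D t z.1 z.2).
  exact: (bounded_measurable_comp mt bD).
have bDt' : bounded_measurable (fun z : S * S => D t z.2 z.1).
  by apply: (bounded_measurable_comp (h := fun z : S * S => (z.2, z.1)) _ bDt);
     exact: measurable_swap.
have bd : bounded_measurable (fun s => D t s s).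
  by apply: (bounded_measurable_comp (h := fun s : S => (s, s)) _ bDt);
     exact: measurable_fun_pair.
have b1 := bounded_measurable_Rintegral Q Q bDt.
have b2 := bounded_measurable_Rintegral Q Q bDt'.
rewrite RintegralB//; try exact: bounded_measurable_integrable.
(* After the exchange the outer variable tests and the inner one trains, so both terms share their
   test sample and [stab] applies under the integral. *)
rewrite (Rintegral_Fubini Q Q bDt) -RintegralB//; try exact: bounded_measurable_integrable.
rewrite -[leRHS](Rintegral_prob_cst Q); apply: le_Rintegral_bounded.
- exact: bounded_measurableB.
- exact: bounded_measurable_cst.
move=> s /=; rewrite lerBlDr -lerBlDl.
rewrite -[leLHS](Rintegral_prob_cst Q); apply: le_Rintegral_bounded.
- exact: bounded_measurable_cst.
- exact: bounded_measurable_slice bDt' s.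
by move=> s'; rewrite lerBlDl -lerBlDr.
Qed.

End ReplaceOne.

(** * The model-based step *)

Section ModelStep.
Context {R : realType} {d : nat} (S : Type) (X : set 'rV[R]_d).
Context (f : 'rV[R]_d -> S -> R) (fm : 'rV[R]_d -> 'rV[R]_d -> S -> R).
Context (lambda tau L gamma : R) (m : nat).
Hypothesis X_convex : convex_set (X : set (convex_lmodType 'rV[R]_d)).
Hypothesis lambda_ge0 : 0 <= lambda.
Hypothesis tau_ge0 : 0 <= tau.
Hypothesis L_gt0 : 0 < L.
Hypothesis model_convex : forall s y, X y -> weakly_convex X lambda (fun z => fm y z s).
Hypothesis model_center : forall s y, X y -> fm y y s = f y s.
Hypothesis model_error : forall s y z, X y -> X z ->
  `|fm y z s - f z s| <= tau / 2 * enorm (y - z) ^+ 2.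
Hypothesis model_lip : forall s y z z', X y -> X z -> X z' ->
  fm y z' s - fm y z s <= L * enorm (z' - z).
Hypothesis m_gt0 : (0 < m)%N.
Hypothesis gamma_gt : lambda < gamma.

Let obj := model_based_objective fm gamma (m := m).

Let gamma_gt0 : 0 < gamma. Proof. exact: le_lt_trans gamma_gt. Qed.

Let strong_gt0 : 0 < gamma - lambda. Proof. by rewrite subr_gt0. Qed.

Let m_gt0R : 0 < m%:R :> R. Proof. by rewrite ltr0n. Qed.

Lemma model_norm_lip s y z z' : X y -> X z -> X z' ->
  `|fm y z' s - fm y z s| <= L * enorm (z' - z).
Proof.
move=> Xy Xz Xz'; rewrite ler_norml model_lip// andbT lerNl opprB.
by rewrite enormB model_lip.
Qed.

(** The detour goes through the model centred at [z]: it is exact at [z], Lipschitz between [z] and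
    [y], and off by at most the quadratic term at [y]. *)
Lemma sample_quadratic_lip s y z : X y -> X z ->
  `|f y s - f z s| <= L * enorm (y - z) + tau / 2 * enorm (y - z) ^+ 2.
Proof.
move=> Xy Xz; rewrite -(model_center s Xz).
rewrite -[f y s - _](subrKA (fm z y s)) addrC.
apply: (le_trans (ler_normD _ _)); apply: lerD; first exact: model_norm_lip.
by rewrite distrC (le_trans (model_error s Xz Xy))// enormB.
Qed.

Lemma objective_wconvex (b : 'I_m -> S) x : X x ->
  wconvex X (- (gamma - lambda)) (obj b x).
Proof.
move=> Xx; rewrite opprB; apply: wconvexD_sqr; apply: wconvex_avg => // i.
exact/weakly_convexP/model_convex.
Qed.

Lemma objective_locally_lipschitz (b : 'I_m -> S) x : X x ->
  locally_lipschitz X (obj b x).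
Proof.
move=> Xx; apply: locally_lipschitzD_sqr.
apply: (@locally_lipschitz_avg _ _ _ _ _ L) => [//|i y z Xy Xz|]; last exact: ltW.
exact: model_norm_lip.
Qed.

Lemma avg_le (a c : 'I_m -> R) : (forall i, a i <= c i) ->
  m%:R^-1 * \sum_(i < m) a i <= m%:R^-1 * \sum_(i < m) c i.
Proof. by move=> ac; rewrite ler_wpM2l ?invr_ge0 ?ler_sum. Qed.

Lemma avg_cst (c : R) : m%:R^-1 * \sum_(i < m) c = c.
Proof. by rewrite sumr_const card_ord -(mulr_natl c) mulKf// gt_eqF. Qed.

Lemma avg_model_lip (b : 'I_m -> S) x z : X x -> X z ->
  m%:R^-1 * (\sum_(i < m) fm x x (b i)) <=
  m%:R^-1 * (\sum_(i < m) fm x z (b i)) + L * enorm (z - x).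
Proof.
move=> Xx Xz; rewrite -[X in _ + X]avg_cst -mulrDr -big_split/=.
by apply: avg_le => i; rewrite -lerBlDl enormB model_lip.
Qed.

(** The method supplies minimizers for the drawn batches only, whereas stability also concerns
    batches in which one sample is replaced. *)
Lemma objective_argmin_exists (b : 'I_m -> S) x : closed X -> X x ->
  exists z, is_argmin X (obj b x) z.
Proof.
move=> clX Xx; apply: (@argmin_exists _ _ X (gamma - lambda)) => //.
- by exists x.
- exact: objective_wconvex.
- exact: objective_locally_lipschitz.
(* The model average decreases at rate at most [L], and [L ^+ 2 / (2 * gamma)] is the maximum of
   [L u - gamma / 2 u^2]. *)
exists (m%:R^-1 * (\sum_(i < m) fm x x (b i)) - L ^+ 2 / (2 * gamma)).
move=> _ [z Xz <-]; rewrite /obj /model_based_objective.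
have := avg_model_lip b Xx Xz.
set u := enorm (z - x); set a := _ * \sum_(i < m) _; set c := _ * \sum_(i < m) _.
have : 0 <= (gamma * u - L) ^+ 2 by exact: sqr_ge0.
have -> : (gamma * u - L) ^+ 2 =
    2 * gamma * (gamma / 2 * u ^+ 2 - L * u + L ^+ 2 / (2 * gamma)).
  by field; rewrite gt_eqF.
rewrite pmulr_rge0 ?mulr_gt0//.
set v := gamma / 2 * _; set e := L * u; set h := L ^+ 2 / _; lra.
Qed.

(** Comparison with staying at [x]: the penalty [gamma / 2 u^2] cannot exceed the possible decrease
    [L u]. Together with [prox_bound] this makes the model gains bounded. *)
Lemma step_bound (b : 'I_m -> S) x z : X x -> is_argmin X (obj b x) z ->
  enorm (z - x) <= 2 * L / gamma.
Proof.
move=> Xx mz; have Xz := mz.1.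
have := argmin_growth X_convex (objective_wconvex b Xx) mz Xx.
have := avg_model_lip b Xx Xz.
rewrite /obj /model_based_objective subrr enorm0 expr0n mulr0 addr0.
rewrite (enormB x z); set u := enorm (z - x).
set a := _ * \sum_(i < m) _; set c := _ * \sum_(i < m) _ => h1 h2.
have u0 : 0 <= u by exact: enorm_ge0.
have su : 0 <= (gamma - lambda) / 2 * u ^+ 2.
  by rewrite mulr_ge0 ?sqr_ge0// divr_ge0// ltW.
have [->|un0] := eqVneq u 0; first by rewrite divr_ge0 ?mulr_ge0// ltW.
have ugt0 : 0 < u by rewrite lt_neqAle eq_sym un0.
rewrite ler_pdivlMr// -(ler_pM2r ugt0).
move: su h1 h2; set v := (gamma - lambda) / 2 * _; lra.
Qed.

(* Both argmins are compared by quadratic growth; only the [i]-th summand differs. *)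
Lemma model_stability (b b' : 'I_m -> S) (i : 'I_m) x z z' s : X x ->
  (forall j, j != i -> b j = b' j) ->
  is_argmin X (obj b x) z -> is_argmin X (obj b' x) z' ->
  fm x z' s - fm x z s <= 2 * L ^+ 2 / (m%:R * (gamma - lambda)).
Proof.
move=> Xx bb' mz mz'; have Xz := mz.1; have Xz' := mz'.1.
have := argmin_growth X_convex (objective_wconvex b Xx) mz Xz'.
have := argmin_growth X_convex (objective_wconvex b' Xx) mz' Xz.
rewrite /obj /model_based_objective (enormB z z'); set u := enorm (z' - z).
rewrite [\sum_(j < m) fm x z' (b' j)](bigD1 i)//=.
rewrite [\sum_(j < m) fm x z (b' j)](bigD1 i)//=.
rewrite [\sum_(j < m) fm x z (b j)](bigD1 i)//=.
rewrite [\sum_(j < m) fm x z' (b j)](bigD1 i)//=.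
rewrite -(eq_bigr _ (fun j ji => congr1 (fm x z') (bb' j ji))).
rewrite -(eq_bigr _ (fun j ji => congr1 (fm x z) (bb' j ji))).
move=> h1 h2; rewrite !mulrDr in h1 h2; move: h1 h2.
set A := _ * \sum_(j < m | _) _; set B := _ * \sum_(j < m | _) _.
set p := gamma / 2 * _; set q := gamma / 2 * _.
have l1 := model_lip (b i) Xx Xz Xz'; have l2 := model_lip (b' i) Xx Xz' Xz.
rewrite (enormB z z') in l2.
have i0 : 0 <= m%:R^-1 :> R by rewrite invr_ge0.
have {l1}l1 := ler_wpM2l i0 l1; have {l2}l2 := ler_wpM2l i0 l2.
rewrite !mulrBr in l1 l2.
move: l1 l2; rewrite -/u.
set a1 := _ * fm x z' (b i); set a2 := _ * fm x z (b i).
set a3 := _ * fm x z (b' i); set a4 := _ * fm x z' (b' i) => l1 l2 h1 h2.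
have u0 : 0 <= u by exact: enorm_ge0.
(* Adding the two growth inequalities cancels the penalties and the common summands. The old and the
   new [i]-th sample remain, each contributing at most [L u / m]. *)
have {}h : (gamma - lambda) * u ^+ 2 <= 2 * (m%:R^-1 * (L * u)).
  by move: l1 l2 h1 h2; set v := u ^+ 2; set e := _ * (L * u); lra.
have {h}uL : u <= 2 * L / (m%:R * (gamma - lambda)).
  have [->|un0] := eqVneq u 0.
    by rewrite divr_ge0 ?mulr_ge0// ltW.
  have ugt0 : 0 < u by rewrite lt_neqAle eq_sym un0.
  rewrite ler_pdivlMr ?mulr_gt0// -(ler_pM2r ugt0).
  have := ler_wpM2l (ltW m_gt0R) h.
  rewrite (mulrCA m%:R 2) mulVKf ?gt_eqF// => h'.
  have -> : u * (m%:R * (gamma - lambda)) * u =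
    m%:R * ((gamma - lambda) * u ^+ 2) by ring.
  by apply: le_trans h' _; rewrite mulrA.
apply: (le_trans (model_lip s Xx Xz Xz')).
apply: (@le_trans _ _ (L * (2 * L / (m%:R * (gamma - lambda))))).
  by rewrite ler_wpM2l// ltW.
by rewrite expr2 !mulrA (mulrC L 2).
Qed.

End ModelStep.

(** * Proximal points *)

Section ProximalPoint.
Context {R : realType} {d : nat} (X : set 'rV[R]_d) (F : 'rV[R]_d -> R).
Context (lambda tau L rho : R).
Hypothesis X_neq0 : X !=set0.
Hypothesis X_closed : closed X.
Hypothesis X_convex : convex_set (X : set (convex_lmodType 'rV[R]_d)).
Hypothesis lambda_ge0 : 0 <= lambda.
Hypothesis tau_ge0 : 0 <= tau.
Hypothesis L_gt0 : 0 < L.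
Hypothesis rho_gt : lambda + tau < rho.
Hypothesis F_lb : has_lbound (F @` X).
Hypothesis F_wconvex : wconvex X (lambda + tau) F.
Hypothesis F_quadratic_lip : forall y z, X y -> X z ->
  `|F y - F z| <= L * enorm (y - z) + tau / 2 * enorm (y - z) ^+ 2.

Let sigma := rho - lambda - tau.

Let sigma_gt0 : 0 < sigma. Proof. by move: rho_gt; rewrite /sigma; lra. Qed.

Let rho_ge0 : 0 <= rho. Proof. by move: rho_gt lambda_ge0 tau_ge0; lra. Qed.

Definition prox_objective (x y : 'rV[R]_d) := F y + rho / 2 * enorm (y - x) ^+ 2.

(** A total function of [x]; the default 0 is never taken, since [prox_argmin] provides a minimizer
    for every [x]. *)
Definition prox x := xget 0 [set z | is_argmin X (prox_objective x) z].

Lemma prox_objective_wconvex x : wconvex X (- sigma) (prox_objective x).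
Proof.
rewrite (_ : - sigma = lambda + tau - rho); last by rewrite /sigma; ring.
exact: wconvexD_sqr.
Qed.

Lemma prox_objective_locally_lipschitz x : locally_lipschitz X (prox_objective x).
Proof.
apply: locally_lipschitzD_sqr => z Xz; exists (L + tau / 2).
  by rewrite addr_ge0 ?divr_ge0// ltW.
move=> y Xy yz; apply: (le_trans (F_quadratic_lip Xy Xz)).
by rewrite mulrDl lerD2l ler_wpM2l ?divr_ge0// expr2 ler_piMr ?enorm_ge0.
Qed.

Lemma prox_argmin x : is_argmin X (prox_objective x) (prox x).
Proof.
apply: (@xgetPex _ 0 [set z | is_argmin X (prox_objective x) z]).
apply: (argmin_exists _ _ _ sigma_gt0) => //.
- exact: prox_objective_wconvex.
- exact: prox_objective_locally_lipschitz.
have := has_lbound_prox x rho_ge0 F_lb.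
by under eq_imagel do rewrite enormB.
Qed.

Lemma prox_in x : X (prox x).
Proof. by have [] := prox_argmin x. Qed.

Lemma prox_growth x y : X y ->
  F (prox x) + rho / 2 * enorm (x - prox x) ^+ 2
    + sigma / 2 * enorm (y - prox x) ^+ 2 <= F y + rho / 2 * enorm (x - y) ^+ 2.
Proof.
rewrite !(enormB x) => Xy.
exact: (argmin_growth X_convex (prox_objective_wconvex x) (prox_argmin x) Xy).
Qed.

Lemma prox_bound x : X x -> enorm (prox x - x) <= 2 * L / (rho - tau).
Proof.
move=> Xx; have := prox_growth x Xx; have Xp := prox_in x.
have := F_quadratic_lip Xx Xp; rewrite subrr enorm0 expr0n mulr0 addr0.
rewrite ler_norml => /andP[_]; rewrite (enormB x); set u := enorm _ => h1 h2.
have rt0 : 0 < rho - tau by move: rho_gt lambda_ge0; lra.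
have u0 : 0 <= u by exact: enorm_ge0.
have su : 0 <= sigma / 2 * u ^+ 2 by rewrite mulr_ge0 ?sqr_ge0// divr_ge0// ltW.
have [->|un0] := eqVneq u 0; first by rewrite divr_ge0 ?mulr_ge0// ltW.
have ugt0 : 0 < u by rewrite lt_neqAle eq_sym un0.
rewrite ler_pdivlMr// -(ler_pM2r ugt0).
by move: su h1 h2; set v := sigma / 2 * _; lra.
Qed.

Lemma moreau_prox x :
  moreau X F rho x = F (prox x) + rho / 2 * enorm (x - prox x) ^+ 2.
Proof.
apply: inf_argmin; split; first exact: prox_in.
move=> y Xy; apply: le_trans (prox_growth x Xy).
by rewrite lerDl mulr_ge0 ?sqr_ge0// divr_ge0// ltW.
Qed.

Lemma enorm_gradient_moreau x :
  enorm (gradient (moreau X F rho) x) ^+ 2 = rho ^+ 2 * enorm (prox x - x) ^+ 2.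
Proof.
rewrite (gradient_moreau rho_ge0 sigma_gt0 F_lb (prox_in x)).
  by rewrite enormZ exprMn real_normK ?num_real// (enormB x).
exact: prox_growth.
Qed.

(* [E] is the error made by testing the model inequality on the batch. *)
Lemma moreau_descent (gamma E : R) x z : X x -> X z ->
  rho + tau <= gamma -> lambda < gamma ->
  gamma / 2 * enorm (z - x) ^+ 2 + (gamma - lambda) / 2 * enorm (prox x - z) ^+ 2
    <= E + (F (prox x) - F z + tau / 2 * enorm (x - prox x) ^+ 2 +
       tau / 2 * enorm (x - z) ^+ 2) + gamma / 2 * enorm (prox x - x) ^+ 2 ->
  enorm (gradient (moreau X F rho) x) ^+ 2 <=
  rho * (rho - 2 * lambda - tau + gamma) / sigma *
    (moreau X F rho x - moreau X F rho z) + rho ^+ 2 / sigma * E.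
Proof.
move=> Xx Xz rtg lg model_ineq.
(* This is [sigma + (gamma - lambda)], the sum of the moduli of the two growth inequalities, both of
   which involve [enorm (prox x - z)]. *)
set c := rho - 2 * lambda - tau + gamma.
have c0 : 0 < c by move: rho_gt lg; rewrite /c; lra.
have := prox_growth x Xz.
have := moreau_le z rho_ge0 F_lb (prox_in x).
rewrite enorm_gradient_moreau (moreau_prox x); move: model_ineq.
rewrite !(enormB x) (enormB z (prox x)).
set p := enorm (z - x) ^+ 2; set q := enorm (prox x - z) ^+ 2.
set n := enorm (prox x - x) ^+ 2; set M := moreau _ _ _ _.
set a := F (prox x); set b := F z => h1 h2 h3.
have p0 : 0 <= (gamma - tau - rho) / 2 * p by rewrite mulr_ge0 ?sqr_ge0// divr_ge0//; lra.
have qle : c / 2 * q <= (gamma + tau - rho) / 2 * n + E.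
  by move: h1 h3 p0; rewrite /c /sigma; lra.
(* Testing the envelope at [z] with [prox x] bounds [M] by [a + rho / 2 * q]. Since
   [c - (gamma + tau - rho) = 2 * sigma], [qle] says that, up to [E], [z] is strictly closer to
   [prox x] than [x] is, and the gap is the decrease of the envelope. *)
have step : sigma * rho ^+ 2 * n <= rho * c * (a + rho / 2 * n - M) + rho ^+ 2 * E.
  have e2 : sigma * rho ^+ 2 * n = rho * c * (rho / 2 * n) -
    rho ^+ 2 * ((gamma + tau - rho) / 2 * n) by rewrite /sigma /c; field.
  rewrite e2; clearbody c.
  have k1 := ler_wpM2l (mulr_ge0 rho_ge0 (ltW c0)) h2.
  have k2 := ler_wpM2l (sqr_ge0 rho) qle.
  have e1 : rho * c * (a + rho / 2 * q) = rho * c * a + rho ^+ 2 * (c / 2 * q) by ring.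
  rewrite e1 in k1; rewrite mulrDr in k2; rewrite mulrBr mulrDr; move: k1 k2.
  set t1 := rho * c * M; set t2 := rho * c * a; set t3 := rho ^+ 2 * (c / 2 * q).
  set t4 := rho ^+ 2 * ((gamma + tau - rho) / 2 * n); set t5 := rho ^+ 2 * E.
  by set t6 := rho * c * (rho / 2 * n); lra.
rewrite -(ler_pM2l sigma_gt0) mulrA; apply: (le_trans step).
rewrite le_eqVlt; apply/orP; left; apply/eqP; field.
by rewrite gt_eqF.
Qed.

End ProximalPoint.

(** * Measurability and expectation *)

Section Measurability.
Context {R : realType} {d : nat}.

Lemma continuous_borel_measurable (g : 'rV[R]_d -> R) : continuous g ->
  measurable_fun [set: borel_rV R d] (g : borel_rV R d -> R).
Proof.
move=> /continuousP cg; apply: (measurability _ (RGenOpens.measurableE R)).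
move=> _ [_ [a [b ->] <-]]; rewrite setTI; apply: sub_sigma_algebra.
exact/cg/interval_open.
Qed.

Lemma measurable_enormB_sqr (dT : measure_display) (T : measurableType dT)
    (a b : T -> 'rV[R]_d) :
  measurable_fun [set: T] (a : T -> borel_rV R d) ->
  measurable_fun [set: T] (b : T -> borel_rV R d) ->
  measurable_fun [set: T] (fun w => enorm (a w - b w) ^+ 2).
Proof.
move=> ma mb; under eq_fun do rewrite enorm_sqr.
have mcoord i (c : T -> 'rV[R]_d) : measurable_fun [set: T] (c : T -> borel_rV R d) ->
    measurable_fun [set: T] (fun w => c w ord0 i).
  move=> mc; apply: (measurableT_comp (f := fun y : borel_rV R d => y ord0 i) _ mc).
  by apply: continuous_borel_measurable; exact: coord_continuous.
apply: measurable_sum => i; apply: measurable_funX.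
under eq_fun do rewrite !mxE.
by apply: measurable_funB; exact: mcoord.
Qed.

Lemma closed_borel_measurable (X : set 'rV[R]_d) : closed X ->
  measurable (X : set (borel_rV R d)).
Proof.
move=> cX; rewrite -[X]setCK; apply: measurableC; apply: sub_sigma_algebra.
exact: closed_openC.
Qed.

(** Measurability of the model is assumed on [X * X * S] only, so the arguments must be known to
    stay in [X], which is measurable because it is closed. *)
Lemma measurable_model (dT dS : measure_display) (T : measurableType dT)
    (S : measurableType dS) (X : set 'rV[R]_d) (fm : 'rV[R]_d -> 'rV[R]_d -> S -> R)
    (a b : T -> 'rV[R]_d) (c : T -> S) :
  closed X ->
  measurable_fun
    (X `*` X `*` [set: S] : set (borel_rV R d * borel_rV R d * S))
    (fun p : borel_rV R d * borel_rV R d * S => fm p.1.1 p.1.2 p.2) ->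
  (forall w, X (a w)) -> (forall w, X (b w)) ->
  measurable_fun [set: T] (a : T -> borel_rV R d) ->
  measurable_fun [set: T] (b : T -> borel_rV R d) ->
  measurable_fun [set: T] c ->
  measurable_fun [set: T] (fun w => fm (a w) (b w) (c w)).
Proof.
move=> cX mfm Xa Xb ma mb mc; have mX := closed_borel_measurable cX.
pose p (w : T) : borel_rV R d * borel_rV R d * S := (a w, b w, c w).
have mXX : measurable (X `*` X `*` [set: S] : set (borel_rV R d * borel_rV R d * S)).
  by apply: measurableX => //; exact: measurableX.
have pX : [set p w | w in [set: T]] `<=` X `*` X `*` [set: S].
  by move=> _ [w _ <-]; split => //=; split.
have mp : measurable_fun [set: T] p.
  by apply: measurable_fun_pair => //; exact: measurable_fun_pair.
exact: (measurable_comp mXX pX mfm mp).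
Qed.

End Measurability.

(** * Weak convexity and continuity of the expected objective *)

Section ExpectedObjective.
Context {R : realType} {d : nat} (dS : measure_display) (S : measurableType dS)
  (Xi : probability S R) (X : set 'rV[R]_d) (f : 'rV[R]_d -> S -> R).
Hypothesis f_int : forall y, X y -> Xi.-integrable [set: S] (EFin \o f y).

Let F := fun y => fine ('E_Xi[f y])%E.

Lemma expected_objectiveE y : F y = \int[Xi]_s f y s.
Proof. by rewrite /F unlock. Qed.

Lemma expected_objective_wconvex l :
  convex_set (X : set (convex_lmodType 'rV[R]_d)) ->
  (forall s, weakly_convex X l (fun y => f y s)) -> wconvex X l F.
Proof.
move=> cX cf y z t Xy Xz t0 t1; rewrite !expected_objectiveE.
have Xc := convex_set_comb cX Xy Xz t0 t1.
set q := l / 2 * _.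
have iZ c u : X u -> Xi.-integrable setT (EFin \o (fun s => c * f u s)).
  by move=> Xu; exact: (integrableZl measurableT _ (f_int Xu)).
have iyz : Xi.-integrable setT (EFin \o (fun s => t * f y s + (1 - t) * f z s)).
  exact: (integrableD measurableT (iZ t y Xy) (iZ (1 - t) z Xz)).
have iq : Xi.-integrable setT (EFin \o (fun _ : S => q)).
  exact: bounded_measurable_integrable (bounded_measurable_cst _ q).
apply: (@le_trans _ _ (\int[Xi]_s (t * f y s + (1 - t) * f z s + q))).
  apply: le_Rintegral => //; first exact: f_int.
    exact: (integrableD measurableT iyz iq).
  by move=> s _; exact: (weakly_convexP (cf s)).
rewrite RintegralD// Rintegral_prob_cst RintegralD//; try exact: iZ.
by rewrite !RintegralZl//; exact: f_int.
Qed.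

Lemma expected_objective_lip (y z : 'rV[R]_d) (q : R) : X y -> X z ->
  (forall s, `|f y s - f z s| <= q) -> `|F y - F z| <= q.
Proof.
move=> Xy Xz fq; rewrite !expected_objectiveE -RintegralB//; try exact: f_int.
have iB : Xi.-integrable setT (EFin \o (fun s => f y s - f z s)).
  exact: (integrableB measurableT (f_int Xy) (f_int Xz)).
apply: (le_trans (le_normr_Rintegral measurableT iB)).
rewrite -[leRHS](Rintegral_prob_cst Xi); apply: le_Rintegral => //.
- exact: (integrable_norm iB).
- exact: bounded_measurable_integrable (bounded_measurable_cst _ q).
Qed.

End ExpectedObjective.

(** * The minibatch method *)

Section Iterates.
Context {R : realType} {d : nat} (X : set 'rV[R]_d)
  (dS : measure_display) (S : measurableType dS) (Xi : probability S R)
  (f : 'rV[R]_d -> S -> R) (fm : 'rV[R]_d -> 'rV[R]_d -> S -> R)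
  (lambda tau mu L rho gamma : R)
  (dO : measure_display) (Omega : measurableType dO) (P : probability Omega R)
  (K m : nat) (x1 : 'rV[R]_d)
  (xi : 'I_K -> 'I_m -> {RV P >-> S}) (x : nat -> Omega -> 'rV[R]_d).
Let F := fun y => fine ('E_Xi[f y])%E.
Let samples := fun ki : 'I_K * 'I_m => xi ki.1 ki.2.
Hypothesis X_closed : closed X.
Hypothesis X_convex : convex_set (X : set (convex_lmodType 'rV[R]_d)).
Hypothesis lambda_ge0 : 0 <= lambda.
Hypothesis tau_ge0 : 0 <= tau.
Hypothesis L_gt0 : 0 < L.
Hypothesis mu_lt : mu < lambda + tau.
Hypothesis fm_measurable : measurable_fun
  (X `*` X `*` [set: S] : set (borel_rV R d * borel_rV R d * S))
  (fun p : borel_rV R d * borel_rV R d * S => fm p.1.1 p.1.2 p.2).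
Hypothesis f_int : forall y, X y -> Xi.-integrable [set: S] (EFin \o f y).
Hypothesis F_lb : has_lbound (F @` X).
Hypothesis f_convex : forall s, weakly_convex X mu (fun y => f y s).
Hypothesis model_convex : forall s y, X y -> weakly_convex X lambda (fun z => fm y z s).
Hypothesis model_center : forall s y, X y -> fm y y s = f y s.
Hypothesis model_error : forall s y z, X y -> X z ->
  `|fm y z s - f z s| <= tau / 2 * enorm (y - z) ^+ 2.
Hypothesis model_lip : forall s y z z', X y -> X z -> X z' ->
  fm y z' s - fm y z s <= L * enorm (z' - z).
Hypothesis rho_gt : lambda + tau < rho.
Hypothesis X_x1 : X x1.
Hypothesis m_gt0 : (0 < m)%N.
Hypothesis xi_law : forall k i A, measurable A -> distribution P (xi k i) A = Xi A.
Hypothesis xi_indep : mutually_independent samples.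
Hypothesis x_method : minibatch_model_based_method X fm gamma xi x1 x.
Hypothesis gamma_ge : rho + tau <= gamma.
Hypothesis gamma_gt : lambda < gamma.

Let obj (b : 'I_m -> S) := model_based_objective fm gamma b.
Let pr := prox X F rho.
Let M := moreau X F rho.

Let X_neq0 : X !=set0. Proof. by exists x1. Qed.

Let F_wconvex : wconvex X (lambda + tau) F.
Proof. by apply: wconvexW (ltW mu_lt) _; exact: expected_objective_wconvex. Qed.

Let F_lip y z : X y -> X z ->
  `|F y - F z| <= L * enorm (y - z) + tau / 2 * enorm (y - z) ^+ 2.
Proof.
move=> Xy Xz; apply: (expected_objective_lip f_int Xy Xz) => s.
exact: (sample_quadratic_lip model_center model_error model_lip).
Qed.

Let pr_in y : X (pr y).
Proof. exact: (prox_in X_neq0 X_closed X_convex lambda_ge0 tau_ge0 L_gt0). Qed.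

Let pr_bound y : X y -> enorm (pr y - y) <= 2 * L / (rho - tau).
Proof. exact: (prox_bound X_neq0 X_closed X_convex lambda_ge0 tau_ge0 L_gt0). Qed.

Let obj_argmin_exists (b : 'I_m -> S) y : X y ->
  exists z, is_argmin X (obj b y) z.
Proof.
exact: (objective_argmin_exists X_convex lambda_ge0 L_gt0 model_convex model_lip
  m_gt0 gamma_gt b X_closed).
Qed.

Let obj_wconvex (b : 'I_m -> S) y : X y -> wconvex X (- (gamma - lambda)) (obj b y).
Proof. exact: (objective_wconvex gamma model_convex m_gt0 b). Qed.

Let strong_gt0 : 0 < gamma - lambda. Proof. by rewrite subr_gt0. Qed.

Lemma iterate_in k w : (k <= K)%N -> X (x k w).
Proof.
case: k => [|k] kK; first by rewrite x_method.1.
by have [] := x_method.2 (Ordinal kK) w.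
Qed.

Lemma measurable_step (dT : measure_display) (T : measurableType dT)
    (a z : T -> 'rV[R]_d) (c : 'I_m -> T -> S) :
  (forall w, X (a w)) -> measurable_fun [set: T] (a : T -> borel_rV R d) ->
  (forall i, measurable_fun [set: T] (c i)) ->
  (forall w, is_argmin X (obj (fun i => c i w) (a w)) (z w)) ->
  measurable_fun [set: T] (z : T -> borel_rV R d).
Proof.
move=> Xa ma mc zP.
apply: (measurable_argmin (Phi := fun w => obj (fun i => c i w) (a w))
  strong_gt0 X_convex) zP => [y Xy|w|w].
- apply: measurable_funD; apply: measurable_funM => //.
    apply: measurable_sum => i.
    exact: (measurable_model X_closed fm_measurable Xa (fun=> Xy)).
  by apply: measurable_enormB_sqr.
- exact: obj_wconvex.
- exact: (objective_locally_lipschitz gamma L_gt0 model_lip m_gt0).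
Qed.

Lemma measurable_prox (dT : measure_display) (T : measurableType dT)
    (a : T -> 'rV[R]_d) : measurable_fun [set: T] (a : T -> borel_rV R d) ->
  measurable_fun [set: T] (fun w => pr (a w) : borel_rV R d).
Proof.
move=> ma; have s0 : 0 < rho - lambda - tau by move: rho_gt; lra.
apply: (measurable_argmin (Phi := fun w => prox_objective F rho (a w))
  s0 X_convex) => [y Xy|w|w|w].
- apply: measurable_funD => //; apply: measurable_funM => //.
  exact: measurable_enormB_sqr.
- exact: prox_objective_wconvex.
- exact: (prox_objective_locally_lipschitz _ tau_ge0 L_gt0).
- exact: (prox_argmin X_neq0 X_closed X_convex lambda_ge0 tau_ge0 L_gt0).
Qed.

(** The iterate numbered [k] uses only batches numbered below [k]. The free source [T] allows any
    sigma-algebra that makes those samples measurable: the one omitting a sample of batch [k], and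
    the one of all samples. *)
Lemma measurable_iterate (dT : measure_display) (T : measurableType dT)
    (h : T -> Omega) (n : nat) :
  (forall (j : 'I_K) i, (j < n)%N -> measurable_fun [set: T] (fun t => xi j i (h t))) ->
  forall k, (k <= n)%N -> (k <= K)%N ->
    measurable_fun [set: T] (fun t => x k (h t) : borel_rV R d).
Proof.
move=> mxi; elim=> [|k IH] kn kK.
  by under eq_fun do rewrite x_method.1; exact: measurable_cst.
apply: (@measurable_step _ _ (fun t => x k (h t)) _
  (fun i t => xi (Ordinal kK) i (h t))) => [t||i|t].
- exact/iterate_in/ltnW.
- by apply: IH; exact: ltnW.
- exact: mxi.
- exact: (x_method.2 (Ordinal kK)).
Qed.

Definition model_gain (k : 'I_K) (w : Omega) (s : S) :=
  fm (x k w) (pr (x k w)) s - fm (x k w) (x k.+1 w) s.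

Definition batch_error (k : 'I_K) (i : 'I_m) (w : Omega) :=
  model_gain k w (xi k i w) - \int[Xi]_s model_gain k w s.

(** [generalization_gap] with the samples other than [(k, i)] as frozen data. The iterate [x k] is a
    function of these, whereas [x k.+1] also depends on the sample [(k, i)]. *)
Lemma batch_error_bound (k : 'I_K) (i : 'I_m) :
  bounded_measurable (batch_error k i) /\
  \int[P]_w batch_error k i w <= 2 * L ^+ 2 / (m%:R * (gamma - lambda)).
Proof.
pose others := fun j : {j | j != (k, i)} => samples (val j).
pose T : measurableType _ := generated_space others.
have mother k' i' : (k', i') != (k, i) ->
    measurable_fun [set: T] (fun t : T => xi k' i' t).
  move=> ne; have mne := @measurable_generated_coord _ _ _ _ _ P _ others
    (exist _ (k', i') ne).
  exact: mne.
have mxk : measurable_fun [set: T] (fun t : T => x k t : borel_rV R d).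
  apply: (@measurable_iterate _ T id k) => [j i' jk||]; last 2 first.
  - by [].
  - exact: ltnW.
  by apply: mother; apply: contraTneq jk => -[-> _]; rewrite ltnn.
have Xk w : X (x k w) by exact/iterate_in/ltnW.
pose batch (t : T) (s : S) := fun j => if j == i then s else xi k j t.
(* The outcome of step [k] when its [i]-th sample is [s] and all else is as in [t]. *)
pose zz (t : T) (s : S) := xget 0 [set z | is_argmin X (obj (batch t s) (x k t)) z].
have zzP t s : is_argmin X (obj (batch t s) (x k t)) (zz t s).
  exact: (xgetPex 0 (obj_argmin_exists (batch t s) (Xk t))).
(* Uniqueness of the minimizer identifies this choice with the iterate that the method happens to
   produce. *)
have zzE w : zz w (xi k i w) = x k.+1 w.
  apply: (argmin_unique strong_gt0 X_convex (obj_wconvex _ (Xk w))).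
    exact: zzP.
  suff -> : batch w (xi k i w) = (fun j => xi k j w) by exact: x_method.2.
  by apply/funext => j; rewrite /batch; case: eqP => [->|].
pose D (t : T) (s s' : S) := fm (x k t) (pr (x k t)) s' - fm (x k t) (zz t s) s'.
have mzz : measurable_fun [set: (T * S)%type]
    (fun z : T * S => zz z.1 z.2 : borel_rV R d).
  apply: (@measurable_step _ _ (fun z : T * S => x k z.1) _
    (fun j z => batch z.1 z.2 j)) => [z||j|z].
  - exact: Xk.
  - exact: (measurableT_comp mxk measurable_fst).
  - rewrite /batch; case: (eqVneq j i) => [_|ji]; first exact: measurable_snd.
    apply: (measurableT_comp _ measurable_fst); apply: mother.
    by apply: contra ji => /eqP[->].
  - exact: zzP.
have bD : bounded_measurable (fun z : (T * S) * S => D z.1.1 z.1.2 z.2).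
  have mx1 : measurable_fun [set: ((T * S) * S)%type]
      (fun z : (T * S) * S => x k z.1.1 : borel_rV R d).
    apply: (measurableT_comp (f := fun z : T * S => x k z.1 : borel_rV R d) _
      measurable_fst).
    exact: (measurableT_comp mxk measurable_fst).
  split.
    apply: measurable_funB; apply: (measurable_model X_closed fm_measurable) => //.
    - exact: measurable_prox.
    - by move=> z; exact: (zzP _ _).1.
    - exact: (measurableT_comp mzz measurable_fst).
  exists (L * (2 * L / (rho - tau) + 2 * L / gamma)) => -[[t s] s'] /=.
  apply: (le_trans (model_norm_lip model_lip _ (Xk t) (zzP t s).1 (pr_in _))).
  rewrite ler_wpM2l ?(ltW L_gt0)//.
  apply: (le_trans (enorm_triangle _ (x k t) _)); apply: lerD; first exact: pr_bound.
  rewrite enormB.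
  exact: (step_bound X_convex lambda_ge0 L_gt0 model_convex model_lip m_gt0 gamma_gt
    (Xk t) (zzP t s)).
have stab t s s' : D t s s - D t s' s <= 2 * L ^+ 2 / (m%:R * (gamma - lambda)).
  (* The proximal point does not depend on the training sample, so its terms cancel and only the
     stability of the step remains. *)
  rewrite /D opprB addrC subrKA.
  apply: (model_stability (i := i) X_convex L_gt0 model_convex model_lip m_gt0
    gamma_gt _ (Xk t) _ (zzP t s) (zzP t s')) => j ji.
  by rewrite /batch (negbTE ji).
have indep A B : measurable A -> measurable B ->
    P ((id : Omega -> T) @^-1` A `&` xi k i @^-1` B) =
    (P ((id : Omega -> T) @^-1` A) * Xi B)%E.
  move=> mA mB; rewrite -(xi_law k i mB).
  exact: (mutually_independent_others xi_indep mA mB).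
have mid : measurable_fun [set: Omega] (id : Omega -> T).
  exact: measurable_generated_id.
have := generalization_gap mid (@measurable_funPT _ _ _ _ (xi k i)) indep bD stab.
suff -> : (fun w => D w (xi k i w) (xi k i w) - \int[Xi]_s D w (xi k i w) s) =
  batch_error k i by [].
by apply/funext => w; rewrite /batch_error /D zzE.
Qed.

(** Measurability is with respect to the samples alone, the sigma-algebra from which the random
    index is independent. *)
Let pr_measurable (k : 'I_K) : bounded_measurable
  (fun w : generated_space samples => enorm (gradient M (x k w)) ^+ 2).
Proof.
have Xk w : X (x k w) by exact/iterate_in/ltnW.
have mxk : measurable_fun [set: generated_space samples]
    (fun w : generated_space samples => x k w : borel_rV R d).
  apply: (@measurable_iterate _ (generated_space samples) id k) => [j i jk||].
  - have mji := @measurable_generated_coord _ _ _ _ _ P _ samples (j, i).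
    exact: mji.
  - by [].
  - exact: ltnW.
rewrite (_ : (fun w => _) = (fun w => rho ^+ 2 * enorm (pr (x k w) - x k w) ^+ 2)).
  apply: bounded_measurableZ; split.
    by apply: measurable_enormB_sqr => //; exact: measurable_prox.
  exists ((2 * L / (rho - tau)) ^+ 2) => w.
  rewrite ger0_norm ?sqr_ge0//; have := pr_bound (Xk w).
  have := enorm_ge0 (pr (x k w) - x k w); set u := enorm _ => u0 ule.
  by rewrite ler_pXn2r// ?nnegrE// (le_trans u0).
apply/funext => w.
exact: (enorm_gradient_moreau X_neq0 X_closed X_convex lambda_ge0 tau_ge0 L_gt0).
Qed.

(** The model error is used from above at the proximal point and from below at the new iterate,
    whence the two [tau / 2] terms. *)
Lemma model_gain_le (k : 'I_K) w :
  \int[Xi]_s model_gain k w s <=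
  F (pr (x k w)) - F (x k.+1 w) + tau / 2 * enorm (x k w - pr (x k w)) ^+ 2 +
    tau / 2 * enorm (x k w - x k.+1 w) ^+ 2.
Proof.
have Xk : X (x k w) by exact/iterate_in/ltnW.
have Xk1 : X (x k.+1 w) by exact: iterate_in.
have Xp := pr_in (x k w).
set z := x k.+1 w in Xk1 *; set y := x k w in Xk Xp *; set p := pr y in Xp *.
have ms u : X u -> measurable_fun [set: S] (fun s => fm y u s).
  by move=> Xu; apply: (measurable_model X_closed fm_measurable (fun=> Xk) (fun=> Xu)).
have bgain : bounded_measurable (model_gain k w).
  split; first by apply: measurable_funB; exact: ms.
  by exists (L * enorm (p - z)) => s; exact: (model_norm_lip model_lip).
rewrite -[leRHS]addrA; set q := (X in _ <= _ + X).
have iq : Xi.-integrable setT (EFin \o (fun _ : S => q)).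
  exact: bounded_measurable_integrable (bounded_measurable_cst _ q).
have iB : Xi.-integrable setT (EFin \o (fun s => f p s - f z s)).
  exact: (integrableB measurableT (f_int Xp) (f_int Xk1)).
rewrite /F !(expected_objectiveE Xi f) -RintegralB//; try exact: f_int.
rewrite -(Rintegral_prob_cst Xi q) -RintegralD//.
apply: le_Rintegral => //.
- exact: bounded_measurable_integrable.
- exact: (integrableD measurableT iB iq).
move=> s _; rewrite /model_gain -/y -/z -/p.
have := model_error s Xk Xp; have := model_error s Xk Xk1.
by rewrite !ler_norml => /andP[h1 _] /andP[_ h2]; rewrite /q; lra.
Qed.

Lemma iterate_descent (k : 'I_K) w :
  enorm (gradient M (x k w)) ^+ 2 <=
  rho * (rho - 2 * lambda - tau + gamma) / (rho - lambda - tau) *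
    (M (x k w) - M (x k.+1 w)) +
  rho ^+ 2 / (rho - lambda - tau) * (m%:R^-1 * \sum_(i < m) batch_error k i w).
Proof.
have Xk : X (x k w) by exact/iterate_in/ltnW.
have Xk1 : X (x k.+1 w) by exact: iterate_in.
apply: (moreau_descent X_neq0 X_closed X_convex lambda_ge0 tau_ge0 L_gt0 rho_gt F_lb
  F_wconvex F_lip Xk Xk1 gamma_ge gamma_gt).
have := argmin_growth X_convex (obj_wconvex (fun i => xi k i w) Xk) (x_method.2 k w)
  (pr_in (x k w)).
have := model_gain_le k w.
have -> : m%:R^-1 * \sum_(i < m) batch_error k i w =
    m%:R^-1 * (\sum_(i < m) fm (x k w) (pr (x k w)) (xi k i w)) -
    m%:R^-1 * (\sum_(i < m) fm (x k w) (x k.+1 w) (xi k i w)) -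
    \int[Xi]_s model_gain k w s.
  rewrite -mulrBr -sumrB -{1}(avg_cst m_gt0 (\int[Xi]_s model_gain k w s)).
  by rewrite -mulrBr -sumrB.
rewrite /obj /model_based_objective -/pr.
set a := m%:R^-1 * _; set b := m%:R^-1 * _; set g := \int[Xi]_s _.
set u1 := tau / 2 * _; set u2 := tau / 2 * _; set u3 := gamma / 2 * _.
set u4 := gamma / 2 * _; set u5 := (gamma - lambda) / 2 * _.
lra.
Qed.

Lemma sum_gradient_le :
  \sum_(k < K) \int[P]_w enorm (gradient M (x k w)) ^+ 2 <=
  rho * (rho - 2 * lambda - tau + gamma) / (rho - lambda - tau) *
    (M x1 - inf (F @` X)) +
  rho ^+ 2 / (rho - lambda - tau) *
    (K%:R * (2 * L ^+ 2 / (m%:R * (gamma - lambda)))).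
Proof.
have s0 : 0 < rho - lambda - tau by move: rho_gt; lra.
have rho0 : 0 <= rho by move: rho_gt lambda_ge0 tau_ge0; lra.
set c1 := rho * _ / _; set c2 := rho ^+ 2 / _; set eps := 2 * L ^+ 2 / _.
have c10 : 0 <= c1.
  rewrite divr_ge0 ?(ltW s0)// mulr_ge0//.
  by move: rho_gt gamma_gt lambda_ge0 tau_ge0; lra.
have c20 : 0 <= c2 by rewrite divr_ge0 ?sqr_ge0// ltW.
pose tot (w : Omega) := \sum_(k < K) (m%:R^-1 * \sum_(i < m) batch_error k i w).
have btot_k (k : 'I_K) : bounded_measurable
    (fun w => m%:R^-1 * \sum_(i < m) batch_error k i w).
  apply: bounded_measurableZ; apply: bounded_measurable_sum => i.
  by have [] := batch_error_bound k i.
have btot : bounded_measurable tot by exact: bounded_measurable_sum.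
have mid : measurable_fun [set: Omega] (id : Omega -> generated_space samples).
  exact: measurable_generated_id.
have bgrad (k : 'I_K) : bounded_measurable
    (fun w : Omega => enorm (gradient M (x k w)) ^+ 2).
  exact: (bounded_measurable_comp mid (pr_measurable k)).
rewrite -(Rintegral_sum P _ bgrad).
(* The sum telescopes for each outcome, with the last envelope value bounded below by the infimum of
   [F]; only the gradients and the batch errors are then integrated. *)
have pointwise w : \sum_(k < K) enorm (gradient M (x k w)) ^+ 2 <=
    c1 * (M x1 - inf (F @` X)) + c2 * tot w.
  apply: (@le_trans _ _ (\sum_(k < K) (c1 * (M (x k w) - M (x k.+1 w)) +
      c2 * (m%:R^-1 * \sum_(i < m) batch_error k i w)))).
    by apply: ler_sum => k _; exact: iterate_descent.
  rewrite big_split/= -mulr_sumr -[X in _ + X <= _]mulr_sumr lerD2r ler_wpM2l//.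
  rewrite -(big_mkord xpredT (fun k => M (x k w) - M (x k.+1 w))).
  rewrite -[X in X <= _]opprK -sumrN.
  under eq_bigr do rewrite opprB.
  rewrite telescope_sumr// opprB (x_method.1 w) lerD2l lerN2.
  exact: inf_le_moreau.
have bub : bounded_measurable (fun w => c1 * (M x1 - inf (F @` X)) + c2 * tot w).
  apply: bounded_measurableD; first exact: bounded_measurable_cst.
  exact: bounded_measurableZ.
apply: (le_trans (le_Rintegral_bounded P (bounded_measurable_sum _ bgrad) bub pointwise)).
have ibtot := bounded_measurable_integrable P btot.
rewrite RintegralD//; last 2 first.
- exact: bounded_measurable_integrable (bounded_measurable_cst _ _).
- exact: bounded_measurable_integrable (bounded_measurableZ _ btot).
rewrite Rintegral_prob_cst lerD2l RintegralZl// ler_wpM2l//.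
rewrite (Rintegral_sum P _ btot_k).
have -> : K%:R * eps = \sum_(k < K) eps by rewrite sumr_const card_ord mulr_natl.
apply: ler_sum => k _.
have bk i := (batch_error_bound k i).1.
rewrite RintegralZl//; last first.
  exact: bounded_measurable_integrable (bounded_measurable_sum _ bk).
rewrite (Rintegral_sum P _ bk) -[leRHS](avg_cst m_gt0).
by apply: avg_le => i; exact: (batch_error_bound k i).2.
Qed.

(** For each outcome exactly one indicator of [kstar = k] is nonzero, and each indicator is
    independent of the gradient at the deterministic index [k]. *)
Lemma expected_gradient_at_random_index (kstar : Omega -> 'I_K) :
  uniform_index P kstar -> independent_index P kstar (generated_sigma_algebra samples) ->
  'E_P[fun w => (enorm (gradient M (x (kstar w) w)) ^+ 2)%R]%E =
  (K%:R^-1 * \sum_(k < K) \int[P]_w enorm (gradient M (x k w)) ^+ 2)%:E.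
Proof.
move=> unif indep.
have mid : measurable_fun [set: Omega] (id : Omega -> generated_space samples).
  exact: measurable_generated_id.
pose C k := kstar @^-1` [set k].
have split_index w : enorm (gradient M (x (kstar w) w)) ^+ 2 =
    \sum_(k < K) ((w \in C k)%:R * enorm (gradient M (x k w)) ^+ 2).
  rewrite (bigD1 (kstar w))//= big1 => [|k kw].
    by rewrite (_ : w \in _) ?mul1r ?addr0//; exact/mem_set.
  rewrite (_ : (w \in _) = false) ?mul0r//; apply/negbTE; apply: contra kw.
  by move=> /set_mem /= ->.
have bC (k : 'I_K) : bounded_measurable
    (fun w => (w \in C k)%:R * enorm (gradient M (x k w)) ^+ 2).
  have [mg [N gN]] := bounded_measurable_comp mid (pr_measurable k).
  split.
    apply: measurable_funM => //.
    by apply: measurable_indic; exact: (unif k).1.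
  exists N => w; rewrite normrM -[leRHS]mul1r; apply: ler_pM => //.
  by case: (w \in C k); rewrite ?normr1 ?normr0.
have /(congr1 (expectation P)) -> := funext split_index.
rewrite expectation_bounded; last exact: bounded_measurable_sum.
rewrite (Rintegral_sum P _ bC).
congr EFin; rewrite mulr_sumr; apply: eq_bigr => k _.
have [mC PC] := unif k.
have indepC A : measurable A -> P (C k `&` (id : Omega -> generated_space samples) @^-1` A) =
    (P (C k) * P ((id : Omega -> generated_space samples) @^-1` A))%E.
  by move=> GA; exact: indep.
rewrite (Rintegral_indep_event mid mC indepC (pr_measurable k)).
by rewrite [X in fine X * _]PC.
Qed.

End Iterates.

(** * Choice of the parameter and the final rate *)

Theorem theorem3p4 (R : realType) (d : nat) (X : set 'rV[R]_d)
    (dS : measure_display) (S : measurableType dS) (Xi : probability S R)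
    (f : 'rV[R]_d -> S -> R) (fm : 'rV[R]_d -> 'rV[R]_d -> S -> R)
    (lambda tau mu L rho : R)
    (dO : measure_display) (Omega : measurableType dO) (P : probability Omega R)
    (K m : nat) (alpha0 : R) (x1 : 'rV[R]_d)
    (xi : 'I_K -> 'I_m -> {RV P >-> S}) (kstar : Omega -> 'I_K)
    (x : nat -> Omega -> 'rV[R]_d) :
  let F := fun y => fine 'E_Xi[f y] in
  let eta := Num.sqrt K%:R / (alpha0 * Num.sqrt m%:R) in
  let gamma := Num.max (rho + tau) (lambda + eta) in
  let Delta := moreau X F rho x1 - inf (F @` X) in
  let samples := fun ki : 'I_K * 'I_m => xi ki.1 ki.2 in
  X !=set0 -> closed X -> convex_set (X : set (convex_lmodType 'rV[R]_d)) ->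
  0 <= lambda -> 0 <= tau -> 0 < L -> mu < lambda + tau ->
  measurable_fun
    (X `*` X `*` [set: S] : set (borel_rV R d * borel_rV R d * S))
    (fun p : borel_rV R d * borel_rV R d * S => fm p.1.1 p.1.2 p.2) ->
  (forall y, X y -> Xi.-integrable [set: S] (EFin \o f y)) ->
  has_lbound (F @` X) ->
  (forall s, {within X, continuous (fun y => f y s)}) ->
  (forall s, weakly_convex X mu (fun y => f y s)) ->
  (forall s y, X y -> weakly_convex X lambda (fun z => fm y z s)) ->
  (forall s y, X y -> fm y y s = f y s) ->
  (forall s y z, X y -> X z ->
    `|fm y z s - f z s| <= tau / 2 * enorm (y - z) ^+ 2) ->
  (forall s y z z', X y -> X z -> X z' ->
    fm y z' s - fm y z s <= L * enorm (z' - z)) ->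
  lambda + tau < rho -> X x1 -> (0 < K)%N -> (0 < m)%N -> 0 < alpha0 ->
  (forall k i A, measurable A -> distribution P (xi k i) A = Xi A) ->
  mutually_independent samples ->
  uniform_index P kstar ->
  independent_index P kstar (generated_sigma_algebra samples) ->
  minibatch_model_based_method X fm gamma xi x1 x ->
  ('E_P[fun w => (enorm (gradient (moreau X F rho) (x (kstar w) w)) ^+ 2)%R] <=
   (rho / (rho - lambda - tau) *
     ((2 * rho - lambda) * Delta / K%:R +
      (Delta / alpha0 + 2 * alpha0 * rho * L ^+ 2) / Num.sqrt (m%:R * K%:R)))%:E)%E.
Proof.
move=> F eta gamma Delta samples X0 clX cX lambda0 tau0 L0 mu_lt mfm f_int F_lb _.
move=> f_cvx m_cvx m_center m_err m_lip rho_gt Xx1 K0 m0 alpha00 xi_law xi_indep.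
move=> unif indep method.
have s0 : 0 < rho - lambda - tau by lra.
have rho0 : 0 < rho by lra.
have KR0 : 0 < K%:R :> R by rewrite ltr0n.
have mR0 : 0 < m%:R :> R by rewrite ltr0n.
pose sK := Num.sqrt K%:R : R; pose sm := Num.sqrt m%:R : R.
have etaE : eta = sK / (alpha0 * sm) by [].
have sK0 : 0 < sK by rewrite sqrtr_gt0.
have sm0 : 0 < sm by rewrite sqrtr_gt0.
have KE : K%:R = sK ^+ 2 by rewrite sqr_sqrtr// ltW.
have mE : m%:R = sm ^+ 2 by rewrite sqr_sqrtr// ltW.
have eta0 : 0 < eta by rewrite etaE divr_gt0// mulr_gt0.
have gamma_ge : rho + tau <= gamma by rewrite /gamma le_max lexx.
have gamma_eta : lambda + eta <= gamma by rewrite /gamma le_max lexx orbT.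
(* Bounding the maximum of two nonnegative numbers by their sum turns the coefficient [c] below into
   at most [2 * rho - lambda + eta]. *)
have gamma_le : gamma <= rho + tau + lambda + eta.
  by rewrite /gamma ge_max; apply/andP; split; lra.
have gamma_gt : lambda < gamma by lra.
have Delta0 : 0 <= Delta by rewrite subr_ge0; apply: inf_le_moreau => //; exact: ltW.
rewrite (expected_gradient_at_random_index clX cX lambda0 tau0 L0 mu_lt mfm f_int F_lb
  f_cvx m_cvx m_center m_err m_lip rho_gt Xx1 m0 method gamma_gt unif indep).
rewrite lee_fin.
have := sum_gradient_le clX cX lambda0 tau0 L0 mu_lt mfm f_int F_lb
  f_cvx m_cvx m_center m_err m_lip rho_gt Xx1 m0 xi_law xi_indep method gamma_ge gamma_gt.
rewrite -/F -/Delta; set G := \sum_(k < K) _ => G_le.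
have iK0 : 0 <= K%:R^-1 :> R by rewrite invr_ge0 ltW.
apply: (le_trans (ler_wpM2l iK0 G_le)).
set c := rho - 2 * lambda - tau + gamma.
rewrite sqrtrM ?ler0n// -/sK -/sm.
have -> : K%:R^-1 * (rho * c / (rho - lambda - tau) * Delta +
    rho ^+ 2 / (rho - lambda - tau) * (K%:R * (2 * L ^+ 2 / (m%:R * (gamma - lambda))))) =
  rho / (rho - lambda - tau) *
    (c * Delta / K%:R + rho * (2 * L ^+ 2 / (m%:R * (gamma - lambda)))).
  by field; rewrite !gt_eqF// ?subr_gt0.
have coef0 : 0 <= rho / (rho - lambda - tau) by rewrite divr_ge0// ltW.
apply: ler_wpM2l => //.
(* The [Delta / alpha0] term is the part [eta * Delta / K] of the descent term; the [L ^+ 2] term is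
   the stability bound with [gamma - lambda] replaced by the smaller [eta]. *)
rewrite (mulrDl (Delta / alpha0)) addrA; apply: lerD.
  have -> : (2 * rho - lambda) * Delta / K%:R + Delta / alpha0 / (sm * sK) =
      (2 * rho - lambda + eta) * Delta / K%:R.
    by rewrite KE etaE; field; rewrite !gt_eqF.
  rewrite ler_pM2r ?invr_gt0// ler_wpM2r// /c; lra.
have -> : 2 * alpha0 * rho * L ^+ 2 / (sm * sK) = rho * (2 * L ^+ 2 / (m%:R * eta)).
  by rewrite mE etaE; field; rewrite !gt_eqF.
apply: ler_wpM2l; first exact: ltW.
apply: ler_wpM2l; first by rewrite mulr_ge0 ?sqr_ge0.
have mg0 : 0 < m%:R * (gamma - lambda) by rewrite mulr_gt0 ?subr_gt0.
have me0 : 0 < m%:R * eta by rewrite mulr_gt0.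
rewrite lef_pV2 ?posrE//; apply: ler_wpM2l; first exact: ltW.
by rewrite lerBrDl.
Qed.
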